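(* Let $X$ be an infinite-dimensional complex Banach space, $T\in L(X)$ and $1\le i\le 9$. Then $$\partial\,\sigma_{\mathbf R_i}(T)\cap\mathrm{acc}\,\sigma_{\mathbf{BR}_i}(T)\subset\partial\,\sigma_{\mathbf{gK}\mathcal M}(T).$$
   Context: $L(X)$ is the algebra of bounded linear operators on $X$; $N(T)$, $R(T)$ are kernel and range; for $K\subset\mathbb C$, $\partial K$ and $\mathrm{acc}\,K$ are the boundary and the set of accumulation points; $\mathbb N_0$ denotes the non-negative integers. $(M,N)\in Red(T)$ means that $M,N$ are closed $T$-invariant subspaces with $X=M\oplus N$; $T_M$, $T_N$ are the restrictions of $T$ viewed as operators on $M$, $N$. $T$ is Kato if $R(T)$ is closed and $N(T)\subset R(T^n)$ for every $n\in\mathbb N$. An operator is meromorphic if every non-zero point of its spectrum is a pole of its resolvent. $T$ admits a generalized Kato-meromorphic decomposition if there is $(M,N)\in Red(T)$ with $T_M$ Kato and $T_N$ meromorphic. $\sigma_{\mathbf{gK}\mathcal M}(T)=\{\lambda\in\mathbb C:T-\lambda I\text{ does not admit a generalized Kato-meromorphic decomposition}\}$. Classes $\mathbf R_i$: $\mathbf R_1$ = bounded below operators; $\mathbf R_2$ = surjective operators; $\mathbf R_3$ = invertible operators; $\mathbf R_4$ = upper semi-Fredholm operators (finite-dimensional kernel, closed range); $\mathbf R_5$ = lower semi-Fredholm operators (range of finite codimension); $\mathbf R_6$ = Fredholm operators; $\mathbf R_7$ = upper semi-Weyl operators (upper semi-Fredholm with index $\le 0$); $\mathbf R_8$ = lower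 semi-Weyl operators (lower semi-Fredholm with index $\ge 0$); $\mathbf R_9$ = Weyl operators (Fredholm of index $0$). The index is $\dim N(T)-\mathrm{codim}\,R(T)$. $T\in\mathbf{BR}_i$ means that there is $n\in\mathbb N_0$ such that $R(T^n)$ is closed and the restriction $T_n:R(T^n)\to R(T^n)$ of $T$ belongs to $\mathbf R_i$ (as an operator on the Banach space $R(T^n)$). It is known that $\mathbf{BR}_1$, $\mathbf{BR}_2$, $\mathbf{BR}_3$ are the classes of left Drazin, right Drazin and Drazin invertible operators respectively. $\sigma_{\mathbf R_i}(T)=\{\lambda\in\mathbb C: T-\lambda I\notin\mathbf R_i\}$ and $\sigma_{\mathbf{BR}_i}(T)=\{\lambda\in\mathbb C: T-\lambda I\notin\mathbf{BR}_i\}$. *)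

(* Defs.v *)
From HB Require Import structures.
From mathcomp Require Import all_boot all_order all_algebra.
From mathcomp Require Import complex.
From mathcomp Require Import all_classical all_reals all_analysis.

Set Implicit Arguments.
Unset Strict Implicit.
Unset Printing Implicit Defensive.

Import Order.TTheory GRing.Theory Num.Theory.
Import numFieldNormedType.Exports.

Local Open Scope classical_set_scope.
Local Open Scope ring_scope.

Definition boundary (T : topologicalType) (A : set T) : set T :=
  closure A `\` interior A.

Section ClosedSubspaces.
Variables (R : realType) (X : completeNormedModType R[i]).

Record closed_subspace := ClosedSubspace {
  csub_set : set X;
  csub0 : csub_set 0;
  csubP : forall (a : R[i]) (u v : X),
    csub_set u -> csub_set v -> csub_set (a *: u + v);
  csub_closed : closed csub_set
}.

Section Carrier.
Variable M : closed_subspace.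

Definition csub_pred : {pred X} := [pred x | x \in csub_set M].

Let csub_submod : submod_closed csub_pred.
Proof.
split=> [|a u v]; rewrite !inE /=; first exact: csub0.
exact: csubP.
Qed.

(* A closed subspace M regarded as a Banach space in its own right, with the
   norm of X restricted to M. *)
Record csub_type : Type := CSub {
  csub_val : X;
  csub_mem : csub_val \in csub_pred
}.

HB.instance Definition _ := [isSub for csub_val].
HB.instance Definition _ := [Choice of csub_type by <:].
HB.instance Definition _ := GRing.isSubmodClosed.Build _ X csub_pred csub_submod.
HB.instance Definition _ := [SubChoice_isSubLmodule of csub_type by <:].

Let nm (u : csub_type) : R[i] := `|csub_val u|.

Let nmD (u v : csub_type) : nm (u + v) <= nm u + nm v.
Proof. exact: ler_normD. Qed.

Let nmZ (l : R[i]) (u : csub_type) : nm (l *: u) = `|l| * nm u.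
Proof. exact: normrZ. Qed.

Let nm0 (u : csub_type) : nm u = 0 -> u = 0.
Proof. by move/normr0_eq0 => u0; apply: val_inj. Qed.

HB.instance Definition _ :=
  Lmodule_isNormed.Build R[i] csub_type nmD nmZ nm0.

Let csub_complete (F : set_system csub_type) :
  ProperFilter F -> cauchy F -> cvg F.
Proof.
move=> FF /cauchyP cF.
have cvF : cvg (csub_val @ F).
  apply: cauchy_cvg; apply/cauchyP => e e0; have [u Fu] := cF e e0.
  exists (csub_val u); rewrite /= /nbhs /=; apply: filterS Fu => v.
  by rewrite -!ball_normE.
have Ml : csub_set M (lim (csub_val @ F)).
  apply: (closed_cvg (u_ := csub_val) (F := F)) cvF; first exact: csub_closed.
  by apply: nearW => u; apply: set_mem; exact: csub_mem u.
apply/cvg_ex; exists (CSub (mem_set Ml)); apply/cvgrPdist_lt => e e0.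
by move/cvgrPdist_lt: cvF => /(_ _ e0).
Qed.

HB.instance Definition _ := Uniform_isComplete.Build csub_type csub_complete.

End Carrier.

End ClosedSubspaces.

Section Operators.
Variables (R : realType) (X : completeNormedModType R[i]).
Implicit Types (T : X -> X) (A : set X) (M N : closed_subspace X).

(* The definitions below take a bare function T : X -> X; they are only meant
   for bounded linear operators, and opshift and restr below preserve that
   property. Subsets of the complex plane are typed set R[i]^o because the
   library puts the topology on R[i]^o and not on R[i]. *)

(* The dimension and codimension of a linear subspace A, in \bar R. The second
   one is the dimension of the quotient X / A: the families below are those
   whose classes modulo A are linearly independent. *)
Definition ldim A : \bar R :=
  ereal_sup [set n%:R%:E | n in [set n : nat |
    exists e : 'I_n -> X, (forall j, A (e j)) /\
      forall a : 'I_n -> R[i], \sum_(j < n) a j *: e j = 0 ->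
        forall j, a j = 0]].

Definition lcodim A : \bar R :=
  ereal_sup [set n%:R%:E | n in [set n : nat |
    exists e : 'I_n -> X,
      forall a : 'I_n -> R[i], A (\sum_(j < n) a j *: e j) ->
        forall j, a j = 0]].

Definition opker T : set X := [set x | T x = 0].

Definition opshift T (l : R[i]) : X -> X := fun x => T x - l *: x.

Definition bounded_inverse T (S : {linear X -> X}) : Prop :=
  [/\ continuous S, cancel T S & cancel S T].

Definition bounded_below T : Prop :=
  exists2 c : R[i], 0 < c & forall x, c * `|x| <= `|T x|.

Definition surjective_op T : Prop := range T = setT.

Definition invertible_op T : Prop := exists S, bounded_inverse T S.

Definition upper_semiFredholm T : Prop :=
  (ldim (opker T) < +oo)%E /\ closed (range T).

Definition lower_semiFredholm T : Prop := (lcodim (range T) < +oo)%E.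

Definition Fredholm T : Prop := upper_semiFredholm T /\ lower_semiFredholm T.

(* Only meaningful when one of the two terms is finite, i.e. for semi-Fredholm
   operators. *)
Definition fredholm_index T : \bar R :=
  (ldim (opker T) - lcodim (range T))%E.

Definition upper_semiWeyl T : Prop :=
  upper_semiFredholm T /\ (fredholm_index T <= 0)%E.

Definition lower_semiWeyl T : Prop :=
  lower_semiFredholm T /\ (0 <= fredholm_index T)%E.

Definition Weyl T : Prop := Fredholm T /\ fredholm_index T = 0%E.

Definition classR (i : nat) T : Prop :=
  match i with
  | 1 => bounded_below T
  | 2 => surjective_op T
  | 3 => invertible_op T
  | 4 => upper_semiFredholm T
  | 5 => lower_semiFredholm T
  | 6 => Fredholm T
  | 7 => upper_semiWeyl T
  | 8 => lower_semiWeyl T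
  | 9 => Weyl T
  | _ => False
  end.

Definition sigmaR (i : nat) T : set R[i]^o :=
  [set l | ~ classR i (opshift T l)].

Definition spectrum T : set R[i]^o :=
  [set l | ~ invertible_op (opshift T l)].

(* Convergence in operator norm. *)
Definition cvg_opnorm (U : nat -> X -> X) (S : X -> X) : Prop :=
  forall e : R[i], 0 < e ->
    \forall n \near \oo, forall x, `|U n x - S x| <= e * `|x|.

(* l0 is a pole, of order p >= 1, of the resolvent m |-> (T - m)^-1: on a
   punctured disc around l0 the resolvent is the sum of a Laurent series
   \sum_(k >= 0) (m - l0)^(k - p) D_k with bounded coefficients and D_0 != 0. *)
Definition resolvent_pole T (l0 : R[i]) : Prop :=
  isolated (spectrum T) l0 /\
  exists (p : nat) (D : nat -> {linear X -> X}) (r : R[i]),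
    [/\ (0 < p)%N, 0 < r, forall k, continuous (D k),
        exists x, D 0%N x != 0 &
        forall m : R[i], 0 < `|m - l0| < r ->
          exists2 S : {linear X -> X}, bounded_inverse (opshift T m) S &
            cvg_opnorm
              (fun n x =>
                 \sum_(k < n) (m - l0) ^ (k%:Z - p%:Z) *: D k x) S].

Definition meromorphic T : Prop :=
  forall l, spectrum T l -> l != 0 -> resolvent_pole T l.

Definition Kato T : Prop :=
  closed (range T) /\ forall n : nat, opker T `<=` range (iter n T).

Definition invariant_sub T M : Prop :=
  forall x, csub_set M x -> csub_set M (T x).

Lemma restr_subproof T M (TM : invariant_sub T M) (u : csub_type M) :
  T (csub_val u) \in csub_pred M.
Proof. exact: mem_set (TM _ (set_mem (csub_mem u))). Qed.

Definition restr T M (TM : invariant_sub T M) :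
    csub_type M -> csub_type M :=
  fun u => CSub (restr_subproof TM u).

Definition direct_sum M N : Prop :=
  (forall x, exists u v, [/\ csub_set M u, csub_set N v & x = u + v]) /\
  csub_set M `&` csub_set N = [set 0].

End Operators.

Section Decompositions.
Variables (R : realType) (X : completeNormedModType R[i]).
Implicit Types T : X -> X.

(* T : X -> X induces an operator T_n on R(T^n); the subspace R(T^n), when it
   is closed, is represented by the closed_subspace M carried by that set. *)
Definition classBR (i : nat) T : Prop :=
  exists (n : nat) (M : closed_subspace X) (TM : invariant_sub T M),
    csub_set M = range (iter n T) /\ classR i (restr TM).

Definition sigmaBR (i : nat) T : set R[i]^o :=
  [set l | ~ classBR i (opshift T l)].

Definition gKM_decomposable T : Prop :=
  exists (M N : closed_subspace X)
    (TM : invariant_sub T M) (TN : invariant_sub T N),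
    [/\ direct_sum M N, Kato (restr TM) & meromorphic (restr TN)].

Definition sigma_gKM T : set R[i]^o :=
  [set l | ~ gKM_decomposable (opshift T l)].

End Decompositions.

(* Main.v *)
Require Import Defs.
From HB Require Import structures.
From mathcomp Require Import all_boot all_order all_algebra.
From mathcomp Require Import complex ring lra.
From mathcomp Require Import all_classical all_reals all_analysis.

Set Implicit Arguments.
Unset Strict Implicit.
Unset Printing Implicit Defensive.

Import Order.TTheory GRing.Theory Num.Theory.
Import numFieldNormedType.Exports.

Local Open Scope classical_set_scope.
Local Open Scope ring_scope.
Local Open Scope complex_scope.

(** Write T for T - l, where l lies in the left-hand side. The membership of an
    operator in each class R_i means that its range is closed and that its
    nullity a and deficiency b satisfy a condition P_i; since P_i(d + a, d + b)
    implies P_i(a, b) for d >= 0, it survives the removal of a common summand.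

    Passing from an operator to its restriction to its own range removes the
    same quantity from a and b. For a semi-Fredholm operator some restriction to
    R(T^d) is Kato, T - m for m <> 0 has the same kernel and cokernel as its
    restriction to R(T^d), and the nullity and deficiency of a Kato operator are
    constant under small scalar shifts. So an operator in R_i has arbitrarily
    small non-zero shifts that are Kato and in R_i, and l is not interior to the
    generalized Kato-meromorphic spectrum.

    Suppose that T had a decomposition with T_M Kato and T_N meromorphic. Each
    T_N - m with m <> 0 becomes invertible on the range of a power, so its
    nullity and deficiency coincide; subtracting them from those of a small
    shift of T lying in R_i gives P_i for T_M - m, for one and hence for all
    small m. Then T - m belongs to BR_i for all small m <> 0, and l is not an
    accumulation point of the BR_i-spectrum. *)

(** * Real-valued norm and bounded operators *)

(** The common summand of nullity and deficiency can be infinite: a meromorphic [T_N - m] may have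
    an infinite-dimensional kernel. It is therefore never subtracted. Every comparison has the form
    (d + a, d + b) against (a, b), and each P_i itself forces d to be finite.

    Quotients are measured by families independent modulo a subspace, and cokernels are treated
    directly next to kernels, without adjoints.

    Local constancy of the dimensions is delicate because a perturbation argument for k independent
    vectors works in a radius that shrinks with k. The way out is a lifting constant valid for all
    shifts in one fixed disc: the admissible step then depends on k but not on the centre, and
    finitely many steps cross the disc.

    The exponent that witnesses membership of T - m in BR_i comes from the N-part alone: it is the
    order of the pole at m, or 0 if T_N - m is invertible. On the range of that power the N-part is
    bijective and contributes nothing, while the Kato part loses equal amounts of nullity and
    deficiency. *)

Section RealNorm.
Variable R : realType.

(* Norms take their values in R[i], which is not totally ordered; rn is the same
   norm with values in R. *)
Definition rn (V : normedZmodType R[i]) (x : V) : R := complex.Re `|x|.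

Lemma rnE (V : normedZmodType R[i]) (x : V) : `|x| = (rn x)%:C.
Proof. by rewrite RRe_real // normr_real. Qed.

Section Zmod.
Variable V : normedZmodType R[i].
Implicit Types x y : V.

Lemma rn_ge0 x : 0 <= rn x.
Proof. by rewrite -ler0c -rnE normr_ge0. Qed.

Lemma rn0 : rn (0 : V) = 0.
Proof. by rewrite /rn normr0. Qed.

Lemma rn_eq0 x : rn x = 0 -> x = 0.
Proof. by move=> x0; apply: normr0_eq0; rewrite rnE x0. Qed.

Lemma rnN x : rn (- x) = rn x.
Proof. by rewrite /rn normrN. Qed.

Lemma rnBC x y : rn (x - y) = rn (y - x).
Proof. by rewrite -rnN opprB. Qed.

Lemma rnD x y : rn (x + y) <= rn x + rn y.
Proof. by rewrite -lecR rmorphD /= -!rnE ler_normD. Qed.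

Lemma rnB x y : rn (x - y) <= rn x + rn y.
Proof. by rewrite -(rnN y) rnD. Qed.

Lemma rn_dist y x z : rn (x - z) <= rn (x - y) + rn (y - z).
Proof. by apply: le_trans (rnD _ _); rewrite addrA subrK. Qed.

Lemma rn_sum n (e : 'I_n -> V) : rn (\sum_(j < n) e j) <= \sum_(j < n) rn (e j).
Proof.
elim/big_ind2: _ => [|x1 x2 y1 y2 h1 h2|//]; first by rewrite rn0.
exact: le_trans (rnD _ _) (lerD h1 h2).
Qed.

Lemma rn_gt0 x : x != 0 -> 0 < rn x.
Proof.
move=> x0; rewrite lt_neqAle rn_ge0 andbT eq_sym; apply: contra x0 => /eqP h.
exact/eqP/rn_eq0.
Qed.

Lemma rn_small0 x : (forall e : R, 0 < e -> rn x <= e) -> x = 0.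
Proof.
move=> h; apply: rn_eq0; apply/eqP; rewrite eq_le rn_ge0 andbT.
by apply/ler_addgt0Pl => e /h; rewrite addr0.
Qed.

End Zmod.

Lemma rnM (a b : R[i]) : rn (a * b) = rn a * rn b.
Proof. by apply: complexI; rewrite rmorphM /= -!rnE normrM. Qed.

Lemma rn1 : rn (1 : R[i]) = 1.
Proof. by rewrite /rn normr1. Qed.

Lemma rnV (a : R[i]) : rn a^-1 = (rn a)^-1.
Proof. by apply: complexI; rewrite fmorphV /= -!rnE normfV. Qed.

Lemma rnX (a : R[i]) n : rn (a ^+ n) = rn a ^+ n.
Proof. by elim: n => [|n IH]; rewrite ?expr0 ?rn1 // !exprS rnM IH. Qed.

Lemma rn_real (r : R) : rn (r%:C) = `|r|.
Proof.
by rewrite /rn normc_def /= expr0n addr0 sqrtr_sqr.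
Qed.

Lemma rnZ (V : normedModType R[i]) (a : R[i]) (x : V) : rn (a *: x) = rn a * rn x.
Proof. by apply: complexI; rewrite rmorphM /= -!rnE normrZ. Qed.

Lemma ltcR_norm (V : normedZmodType R[i]) (x : V) (e : R) :
  (`|x| < e%:C) = (rn x < e).
Proof. by rewrite rnE ltcR. Qed.

Lemma posC (e : R[i]) : 0 < e -> e = (complex.Re e)%:C /\ 0 < complex.Re e.
Proof.
move=> e0; have h : e = (complex.Re e)%:C by rewrite RRe_real // gtr0_real.
by split=> //; rewrite -ltcR -h.
Qed.

Section Topology.
Variable V : normedModType R[i].

Lemma nbhs_rnP (x : V) (A : set V) :
  nbhs x A <-> exists2 e : R, 0 < e & forall y, rn (x - y) < e -> A y.
Proof.
split=> [/nbhs_normP[e /= e0 h]|[e e0 h]].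
  have [eE e1] := posC e0; exists (complex.Re e) => // y hy; apply: h.
  by rewrite /= eE ltcR_norm.
apply/nbhs_normP; exists e%:C; first by rewrite /= ltcR.
by move=> y /=; rewrite ltcR_norm; exact: h.
Qed.

Lemma closed_rnP (A : set V) :
  closed A <-> forall x, (forall e : R, 0 < e -> exists2 a, A a & rn (x - a) < e) -> A x.
Proof.
split=> [cA x h|h x clx].
  apply: cA => B /nbhs_rnP[e e0 hB]; have [a Aa xa] := h e e0.
  by exists a; split=> //; exact: hB.
apply: h => e e0; have [|a [Aa xa]] := clx [set y | rn (x - y) < e].
  by apply/nbhs_rnP; exists e.
by exists a.
Qed.

End Topology.

Lemma nbhs_CP (l : R[i]^o) (A : set R[i]^o) :
  nbhs l A <-> exists2 e : R, 0 < e & forall m : R[i], rn m < e -> A (l + m).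
Proof.
split=> [/nbhs_rnP[e e0 h]|[e e0 h]].
  exists e => // m hm; apply: h; have -> : l - (l + m : R[i]^o) = - m by ring.
  by rewrite rnN.
apply/nbhs_rnP; exists e => // y hy.
have -> : y = l + (y - l) by ring.
by apply: h; rewrite (_ : rn _ = rn (l - y)) // rnBC.
Qed.

Lemma half_pow_lt (K e : R) : 0 < e -> exists N : nat, K * 2^-1 ^+ N < e.
Proof.
move=> e0; exists (Num.bound (K / e)).
have := upper_nthrootP (leqnn (Num.bound (K / e))).
by rewrite exprVn ltr_pdivrMr // mulrC -ltr_pdivrMr ?exprn_gt0 // mulrC.
Qed.

Section Complete.
Variable X : completeNormedModType R[i].

Lemma rn_cauchy (u : nat -> X) :
  (forall e : R, 0 < e -> exists N, forall m n, (N <= m)%N -> (N <= n)%N -> rn (u m - u n) < e) ->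
  exists l, forall e : R, 0 < e -> exists N, forall n, (N <= n)%N -> rn (u n - l) < e.
Proof.
move=> h; have : cvg (u @ \oo).
  apply: cauchy_cvg; apply/cauchyP => e e0; have [eE e1] := posC e0.
  have [N hN] := h _ e1; exists (u N); exists N => // n /= Nn.
  by rewrite -ball_normE /= eE ltcR_norm; apply: hN.
move/cvg_ex => [l /cvgrPdist_lt hl]; exists l => e e0.
have [|N _ hN] := hl e%:C; first by rewrite ltcR.
by exists N => n /hN /=; rewrite ltcR_norm rnBC.
Qed.

Lemma rn_geometric (u : nat -> X) (K : R) :
  0 <= K -> (forall n, rn (u n.+1 - u n) <= K * 2^-1 ^+ n) ->
  exists l, forall n, rn (u n - l) <= 2 * K * 2^-1 ^+ n.
Proof.
move=> K0 h.
(* The factor [1 - 2^-1 ^+ k] is the exact partial geometric sum; the bound without it would not be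
   inductive. *)
have hk n k : rn (u (n + k)%N - u n) <= 2 * K * 2^-1 ^+ n * (1 - 2^-1 ^+ k).
  elim: k => [|k IH]; first by rewrite addn0 subrr rn0 expr0 subrr mulr0.
  rewrite addnS; apply: le_trans (rn_dist (u (n + k)%N) _ _) _.
  apply: le_trans (lerD (h _) IH) _; rewrite exprD exprS.
  by set a := _ ^+ n; set b := _ ^+ k; lra.
have p0 n : 0 <= 2^-1 ^+ n :> R by apply: exprn_ge0.
have hmn n m : (n <= m)%N -> rn (u m - u n) <= 2 * K * 2^-1 ^+ n.
  move=> /subnKC <-; apply: le_trans (hk _ _) _.
  rewrite ler_piMr ?mulr_ge0 //; have := p0 (m - n)%N; lra.
have geo (e : R) : 0 < e -> exists N, 2 * K * 2^-1 ^+ N < e.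
  exact: half_pow_lt.
have [|l hl] := @rn_cauchy u.
  move=> e e0; have [|N hN] := geo (e / 2); first lra.
  exists N => m n Nm Nn; apply: le_lt_trans (rn_dist (u N) _ _) _.
  have := hmn _ _ Nm; have := hmn _ _ Nn; rewrite (rnBC (u N) (u n)); lra.
exists l => n; apply/ler_addgt0Pl => e e0; have [N hN] := hl e e0.
apply: le_trans (rn_dist (u (maxn n N)) _ _) _.
have := hN (maxn n N) (leq_maxr _ _); have := hmn n _ (leq_maxl n N).
rewrite (rnBC (u n)); lra.
Qed.
End Complete.

Section Bop.
Variables X Y : normedModType R[i].

Definition bop (T : X -> Y) : Prop :=
  (forall a x y, T (a *: x + y) = a *: T x + T y) /\
  exists2 K : R, 0 < K & forall x, rn (T x) <= K * rn x.

Section BopTheory.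
Variables (T : X -> Y) (bT : bop T).

Lemma bopD x y : T (x + y) = T x + T y.
Proof. by have := bT.1 1 x y; rewrite !scale1r. Qed.

Lemma bop0 : T 0 = 0.
Proof. by apply: (addrI (T 0)); rewrite -bopD !addr0. Qed.

Lemma bopZ a x : T (a *: x) = a *: T x.
Proof. by have := bT.1 a x 0; rewrite !addr0 bop0 addr0. Qed.

Lemma bopN x : T (- x) = - T x.
Proof. by rewrite -scaleN1r bopZ scaleN1r. Qed.

Lemma bopB x y : T (x - y) = T x - T y.
Proof. by rewrite bopD bopN. Qed.

Lemma bop_sum n (e : 'I_n -> X) : T (\sum_(j < n) e j) = \sum_(j < n) T (e j).
Proof. by elim/big_ind2: _ => [|? ? ? ? <- <-|//]; rewrite ?bop0 ?bopD. Qed.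

End BopTheory.

Lemma bop_continuous (T : X -> Y) : bop T -> continuous T.
Proof.
move=> bT x; have [_ [K K0 hK]] := bT; apply/cvgrPdist_lt => e e0.
have [-> e1] := posC e0; apply/nbhs_rnP; exists (complex.Re e / K).
  by rewrite divr_gt0.
move=> y hy /=; rewrite ltcR_norm -bopB //; apply: le_lt_trans (hK _) _.
by rewrite mulrC -ltr_pdivlMr.
Qed.

Lemma continuous_bop (T : {linear X -> Y}) : continuous T -> bop T.
Proof.
move=> cT; split=> [a x y|]; first exact: linearP.
have /cvgrPdist_lt/(_ 1 ltr01)/nbhs_rnP[d d0 hd] := cT 0.
exists (2 / d); first by rewrite divr_gt0.
move=> x; have [->|x0] := eqVneq x 0; first by rewrite linear0 !rn0 mulr0.
have r0 := rn_gt0 x0.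
(* Rescaling [x] to norm [d / 2] puts it in the ball where [T] has norm below one; hence the
   constant [2 / d]. *)
pose c : R := d / 2 / rn x.
have c0 : 0 < c by rewrite !divr_gt0.
have := hd (c%:C *: x); rewrite sub0r rnN rnZ rn_real (gtr0_norm c0) /= linear0 sub0r.
rewrite divfK ?gt_eqF // linearZ normrN (_ : 1 = (1:R)%:C) // ltcR_norm rnZ rn_real.
rewrite (gtr0_norm c0) => h.
have {}h : c * rn (T x) < 1 by apply: h; lra.
rewrite /c in h; have : rn (T x) < (d / 2 / rn x)^-1.
  by rewrite -[ltRHS]mul1r ltr_pdivlMr ?divr_gt0 // mulrC.
rewrite !invf_div => h'; apply: ltW; apply: lt_le_trans h' _.
by rewrite le_eqVlt; apply/orP; left; apply/eqP; field; rewrite !gt_eqF.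
Qed.

End Bop.

Lemma bop_comp (X Y Z : normedModType R[i]) (T : X -> Y) (S : Y -> Z) :
  bop T -> bop S -> bop (S \o T).
Proof.
move=> bT bS; split=> [a x y|]; first by rewrite /= bT.1 bS.1.
have [_ [K K0 hK]] := bT; have [_ [L L0 hL]] := bS.
exists (L * K); first exact: mulr_gt0.
move=> x /=; apply: le_trans (hL _) _; rewrite -mulrA ler_pM2l //; exact: hK.
Qed.

Lemma bop_id (X : normedModType R[i]) : bop (@id X).
Proof. by split=> //; exists 1 => // x; rewrite mul1r. Qed.

Lemma bop_iter (X : normedModType R[i]) (T : X -> X) n : bop T -> bop (iter n T).
Proof.
move=> bT; elim: n => [|n IH]; first exact: bop_id.
exact: (bop_comp IH bT).
Qed.

Lemma bop_add (X Y : normedModType R[i]) (T S : X -> Y) :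
  bop T -> bop S -> bop (fun x => T x + S x).
Proof.
move=> bT bS; split=> [a x y|]; first by rewrite bT.1 bS.1 scalerDr addrACA.
have [_ [K K0 hK]] := bT; have [_ [L L0 hL]] := bS.
exists (K + L); first exact: addr_gt0.
by move=> x; rewrite mulrDl; exact: le_trans (rnD _ _) (lerD (hK x) (hL x)).
Qed.

Lemma bop_scale (X : normedModType R[i]) (a : R[i]) : bop (fun x : X => a *: x).
Proof.
split=> [b x y|]; first by rewrite scalerDr !scalerA mulrC.
exists (rn a + 1) => [|x]; first by have := rn_ge0 a; lra.
by rewrite rnZ ler_wpM2r ?rn_ge0 //; lra.
Qed.

Lemma opshiftE (X : completeNormedModType R[i]) (T : X -> X) m x :
  opshift T m x = T x - m *: x.
Proof. by []. Qed.

Lemma bop_opshift (X : completeNormedModType R[i]) (T : X -> X) m :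
  bop T -> bop (opshift T m).
Proof.
move=> bT; have := bop_add bT (@bop_scale X (- m)).
by congr bop; apply/funext => x; rewrite opshiftE scaleNr.
Qed.

Lemma opshiftD (X : completeNormedModType R[i]) (T : X -> X) l m :
  opshift (opshift T l) m = opshift T (l + m).
Proof. by apply/funext => x; rewrite !opshiftE scalerDl opprD addrA. Qed.

End RealNorm.

(** * Open mapping theorem *)

(** Dependent choice with an invariant [P] and a relation [Q] between consecutive terms. The chosen
    step is made total by letting it be constant where [P] fails. *)
Lemma dep_choice (A : Type) (P : nat -> A -> Prop) (Q : nat -> A -> A -> Prop) a0 :
  P 0%N a0 -> (forall n a, P n a -> exists2 a', P n.+1 a' & Q n a a') ->
  exists u : nat -> A, u 0%N = a0 /\ forall n, P n (u n) /\ Q n (u n) (u n.+1).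
Proof.
move=> P0 step.
have /choice[f hf] : forall na : nat * A, exists a', P na.1 na.2 ->
    P na.1.+1 a' /\ Q na.1 na.2 a'.
  move=> [n a]; have [h|h] := pselect (P n a); last by exists a.
  by have [a' ? ?] := step _ _ h; exists a'.
pose u := fix u n := if n is n'.+1 then f (n', u n') else a0.
have Pu n : P n (u n) by elim: n => [//|n IH]; exact: (hf (n, u n) IH).1.
by exists u; split=> // n; split=> //; exact: (hf (n, u n) (Pu n)).2.
Qed.

Section OpenMapping.
Variable R : realType.

(** Baire's theorem: if no [B n] were dense in a ball, every ball would contain a smaller one at
    positive distance from [B n], and the common point of such nested balls would lie in no
    [B n]. *)
Lemma rn_baire (X : completeNormedModType R[i]) (B : nat -> set X) :
  (forall x, exists n, B n x) ->
  exists n x, exists2 r : R, 0 < r & forall y, rn (y - x) < r ->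
    forall e : R, 0 < e -> exists2 b, B n b & rn (y - b) < e.
Proof.
move=> cover; apply: contrapT => nope.
have step n (p : X * R) : 0 < p.2 -> exists2 q : X * R, 0 < q.2 &
    [/\ rn (q.1 - p.1) <= p.2 / 2, q.2 <= p.2 / 2 &
        forall b, B n b -> q.2 < rn (q.1 - b)].
  case: p => x r /= r0; apply: contrapT => no; apply: nope.
  exists n, x, (r / 2); first by rewrite divr_gt0.
  move=> y yx e e0; apply: contrapT => nob; apply: no.
  exists (y, Num.min (r / 2) (e / 2)) => /=.
    by rewrite lt_min !divr_gt0.
  split; [exact: ltW|by rewrite ge_min lexx|move=> b Bb].
  rewrite gt_min; apply/orP; right; rewrite ltNge; apply/negP => h.
  by apply: nob; exists b => //; lra.
have [u [u0 hu]] := @dep_choice _ (fun _ p => 0 < p.2) _ (0 : X, 1 : R) ltr01 step.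
have r0 n : 0 < (u n).2 by case: (hu n).
have hr n : (u n).2 <= 2^-1 ^+ n.
  elim: n => [|n IH]; first by rewrite u0 expr0.
  by have [_ [_ h _]] := hu n; rewrite exprS; lra.
(* Distances of centres are bounded by differences of radii, so the limit stays in every closed
   ball. *)
have nest n k : rn ((u (n + k)%N).1 - (u n).1) <= (u n).2 - (u (n + k)%N).2.
  elim: k => [|k IH]; first by rewrite addn0 !subrr rn0.
  rewrite addnS; apply: le_trans (rn_dist (u (n + k)%N).1 _ _) _.
  by have [_ [h1 h2 _]] := hu (n + k)%N; lra.
have [|l hl] := @rn_geometric _ _ (fun n => (u n).1) 1 ler01.
  move=> n; have [_ [h _ _]] := hu n; rewrite mul1r; apply: le_trans h _.
  by have := hr n; have := r0 n; lra.
have [n Bn] := cover l; have [_ [_ _ /(_ _ Bn)]] := hu n.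
apply/negP; rewrite -leNgt; apply/ler_addgt0Pl => e e0.
have [N hN] := half_pow_lt (2 * 1) e0.
apply: le_trans (rn_dist (u (n.+1 + N)%N).1 _ _) _.
have h1 := nest n.+1 N; have h2 := r0 (n.+1 + N)%N; have h3 := hl (n.+1 + N)%N.
have h4 : 2 * 1 * 2^-1 ^+ (n.+1 + N) <= 2 * 1 * 2^-1 ^+ N :> R.
  apply: ler_wpM2l; first lra.
  by rewrite exprD ler_piMl ?exprn_ge0 // exprn_ile1 //; lra.
rewrite (rnBC (u n.+1).1); lra.
Qed.

(** This bounds the reduced minimum modulus of [T] below by the inverse of [C], phrased without the
    quotient by the kernel. *)
Definition liftable (X Y : normedModType R[i]) (C : R) (T : X -> Y) : Prop :=
  forall x, exists2 x', T x' = T x & rn x' <= C * rn (T x).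

(* The source is split into two Banach spaces so that this applies both to one
   operator and to an operator together with a complement of its range. *)
Lemma approx_solve (X1 X2 : completeNormedModType R[i]) (Y : normedModType R[i])
    (S1 : X1 -> Y) (S2 : X2 -> Y) (K : R) :
  bop S1 -> bop S2 -> 0 <= K ->
  (forall y, exists x1 x2, [/\ rn x1 <= K * rn y, rn x2 <= K * rn y &
     rn (y - (S1 x1 + S2 x2)) <= rn y / 2]) ->
  forall y, exists x1 x2, [/\ rn x1 <= 2 * K * rn y, rn x2 <= 2 * K * rn y &
     y = S1 x1 + S2 x2].
Proof.
move=> b1 b2 K0 step y.
(* Successive approximation: the residual halves at each step, so the corrections form a geometric
   series, which doubles [K]. *)
pose P n (p : X1 * X2) := rn (y - (S1 p.1 + S2 p.2)) <= rn y * 2^-1 ^+ n.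
pose Q n (p q : X1 * X2) := rn (q.1 - p.1) <= K * rn y * 2^-1 ^+ n /\
  rn (q.2 - p.2) <= K * rn y * 2^-1 ^+ n.
have [||u [u0 hu]] := @dep_choice _ P Q (0, 0).
- by rewrite /P /= (bop0 b1) (bop0 b2) addr0 subr0 expr0 mulr1.
- move=> n [p1 p2] hP; have [x1 [x2 [h1 h2 h3]]] := step (y - (S1 p1 + S2 p2)).
  have hK : K * rn (y - (S1 p1 + S2 p2)) <= K * rn y * 2^-1 ^+ n.
    by rewrite -mulrA ler_wpM2l.
  exists (p1 + x1, p2 + x2).
    rewrite /P /= (bopD b1) (bopD b2) addrACA opprD addrA; apply: le_trans h3 _.
    by rewrite exprS; move: hP; rewrite /P /=; lra.
  by split; rewrite /= addrC addKr; [exact: le_trans h1 _|exact: le_trans h2 _].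
have K'0 : 0 <= K * rn y by rewrite mulr_ge0 ?rn_ge0.
have [|l1 hl1] := @rn_geometric _ _ (fun n => (u n).1) _ K'0.
  by move=> n; have [_ []] := hu n.
have [|l2 hl2] := @rn_geometric _ _ (fun n => (u n).2) _ K'0.
  by move=> n; have [_ []] := hu n.
exists l1, l2; split.
- by have := hl1 0%N; rewrite u0 sub0r rnN expr0 mulr1 mulrA.
- by have := hl2 0%N; rewrite u0 sub0r rnN expr0 mulr1 mulrA.
have [_ [K1 K10 hK1]] := b1; have [_ [K2 K20 hK2]] := b2.
apply/eqP; rewrite -subr_eq0; apply/eqP/rn_small0 => e e0.
have [n hn] := half_pow_lt (rn y + K1 * (2 * (K * rn y)) + K2 * (2 * (K * rn y))) e0.
have -> : y - (S1 l1 + S2 l2) =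
    (y - (S1 (u n).1 + S2 (u n).2)) + (S1 ((u n).1 - l1) + S2 ((u n).2 - l2)).
  by rewrite (bopB b1) (bopB b2) [X in _ = _ + X]addrACA -opprD addrA subrK.
apply/ltW/le_lt_trans/hn; apply: le_trans (rnD _ _) _.
rewrite (mulrDl (_ + _)) (mulrDl (rn y)) -addrA; apply: lerD; first by have [] := hu n.
apply: le_trans (rnD _ _) _; apply: lerD.
  by apply: le_trans (hK1 _) _; rewrite -[leRHS]mulrA ler_pM2l.
by apply: le_trans (hK2 _) _; rewrite -[leRHS]mulrA ler_pM2l.
Qed.

(** By Baire, the images of pairs of norm at most some [n] are dense in a ball. Subtracting two of
    them moves the ball to the origin and gives approximate solutions, which [approx_solve] turns
    into exact ones. *)
Lemma open_mapping2 (X1 X2 Y : completeNormedModType R[i])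
    (S1 : X1 -> Y) (S2 : X2 -> Y) :
  bop S1 -> bop S2 -> (forall y, exists x1 x2, y = S1 x1 + S2 x2) ->
  exists2 C : R, 0 < C & forall y, exists x1 x2,
    [/\ rn x1 <= C * rn y, rn x2 <= C * rn y & y = S1 x1 + S2 x2].
Proof.
move=> b1 b2 surj.
pose B (n : nat) := [set y | exists x1 x2,
  [/\ rn x1 <= n%:R, rn x2 <= n%:R & y = S1 x1 + S2 x2]].
have [|n [y0 [r r0 hr]]] := @rn_baire Y B.
  move=> y; have [x1 [x2 ->]] := surj y; exists (Num.bound (rn x1 + rn x2)), x1, x2.
  have := archi_boundP (addr_ge0 (rn_ge0 x1) (rn_ge0 x2)).
  by have := rn_ge0 x1; have := rn_ge0 x2; split=> //; lra.
(* Scaling by [t = r / (2 |y|)] brings [y] into the ball; two preimages of norm at most [n], divided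
   by [t], give [4 n |y| / r]. The added 1 keeps [K] positive. *)
pose K : R := 4 * n%:R / r + 1.
have K1 : 0 < K.
  by rewrite /K ltr_wpDl // divr_ge0 ?mulr_ge0 // ltW.
have main y : exists x1 x2, [/\ rn x1 <= K * rn y, rn x2 <= K * rn y &
     rn (y - (S1 x1 + S2 x2)) <= rn y / 2].
  have [->|ny] := eqVneq y 0.
    by exists 0, 0; rewrite (bop0 b1) (bop0 b2) addr0 subr0 !rn0 mulr0 mul0r; split.
  have y1 := rn_gt0 ny; pose t : R := r / 2 / rn y.
  have t0 : 0 < t by rewrite !divr_gt0.
  have tV : t * rn y = r / 2 by rewrite /t divfK ?gt_eqF.
  (* Two errors of [r / 8] add up to [r / 4], which is half of [t * rn y]. *)
  have e0 : 0 < r / 8 by lra.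
  have [|b [p1 [p2 [hp1 hp2 ->]]] hb] := hr (y0 + t%:C *: y) _ _ e0.
    by rewrite addrC addKr rnZ rn_real gtr0_norm // tV; lra.
  have [|b' [q1 [q2 [hq1 hq2 ->]]] hb'] := hr y0 _ _ e0.
    by rewrite subrr rn0.
  have tC0 : t%:C != 0 by rewrite (inj_eq (@complexI _) t 0) gt_eqF.
  have bnd (V : completeNormedModType R[i]) (p q : V) : rn p <= n%:R -> rn q <= n%:R ->
      rn (t%:C^-1 *: (p - q)) <= K * rn y.
    move=> hp hq; rewrite rnZ rnV rn_real gtr0_norm //.
    have hpq : rn (p - q) <= 2 * n%:R by have := rnB p q; lra.
    apply: (@le_trans _ _ (t^-1 * (2 * n%:R))).
      by rewrite ler_pM2l // invr_gt0.
    rewrite /K (mulrDl (_ / r)) mul1r; apply: ler_wpDr; first exact: ltW.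
    rewrite le_eqVlt; apply/orP; left; apply/eqP; rewrite /t; field.
    by rewrite !gt_eqF.
  exists (t%:C^-1 *: (p1 - q1)), (t%:C^-1 *: (p2 - q2)); split; [exact: bnd|exact: bnd|].
  have -> : y - (S1 (t%:C^-1 *: (p1 - q1)) + S2 (t%:C^-1 *: (p2 - q2))) =
     t%:C^-1 *: ((y0 + t%:C *: y - (S1 p1 + S2 p2)) - (y0 - (S1 q1 + S2 q2))).
    rewrite !(bopZ b1, bopZ b2, bopB b1, bopB b2).
    apply: (scalerI tC0); rewrite scalerA divff // scale1r.
    rewrite scalerBr scalerDr !scalerA divff // !scale1r.
    set sp := S1 p1 + S2 p2; set sq := S1 q1 + S2 q2.
    have -> : y0 + t%:C *: y - sp - (y0 - sq) = t%:C *: y - (sp - sq).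
      by rewrite [y0 + _]addrC -addrA -addrA; congr (_ + _); rewrite !opprB addrC -addrA subrK addrC.

    by congr (_ - _); rewrite /sp /sq opprD addrACA.
  rewrite rnZ rnV rn_real gtr0_norm // mulrC ler_pdivrMr //.
  have := rnB (y0 + t%:C *: y - (S1 p1 + S2 p2)) (y0 - (S1 q1 + S2 q2)).
  lra.
exists (2 * K); first lra.
by apply: approx_solve => //; exact: ltW.
Qed.

(** * Linear subspaces, and closed ranges through the open mapping theorem *)

Definition subsp (V : lmodType R[i]) (A : set V) : Prop :=
  A 0 /\ forall a x y, A x -> A y -> A (a *: x + y).

Section Subsp.
Variables (V : lmodType R[i]) (A : set V) (sA : subsp A).

Lemma subspD x y : A x -> A y -> A (x + y).
Proof. by move=> Ax Ay; rewrite -[x]scale1r; exact: sA.2. Qed.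

Lemma subspZ a x : A x -> A (a *: x).
Proof. by move=> Ax; rewrite -[_ *: _]addr0; apply: sA.2 => //; exact: sA.1. Qed.

Lemma subspN x : A x -> A (- x).
Proof. by rewrite -scaleN1r; exact: subspZ. Qed.

Lemma subspB x y : A x -> A y -> A (x - y).
Proof. by move=> Ax Ay; apply: subspD => //; exact: subspN. Qed.

Lemma subsp_sum n (e : 'I_n -> V) : (forall j, A (e j)) -> A (\sum_(j < n) e j).
Proof. by move=> h; elim/big_ind: _ => //; [exact: sA.1|exact: subspD]. Qed.

Lemma subspDr x y : A y -> A (x + y) -> A x.
Proof. by move=> Ay Axy; rewrite -[x](addrK y); exact: subspB. Qed.

End Subsp.

Lemma subspT (V : lmodType R[i]) : subsp [set: V].
Proof. by []. Qed.

Lemma subsp0 (V : lmodType R[i]) : subsp [set (0 : V)].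
Proof. by split=> // a x y /= -> ->; rewrite scaler0 addr0. Qed.

Lemma subspI (V : lmodType R[i]) (A B : set V) : subsp A -> subsp B -> subsp (A `&` B).
Proof.
move=> sA sB; split=> [|a x y [? ?] [? ?]]; first by split; [exact: sA.1|exact: sB.1].
by split; [exact: sA.2|exact: sB.2].
Qed.

Definition addset (V : lmodType R[i]) (A B : set V) : set V :=
  [set x | exists a b, [/\ A a, B b & x = a + b]].

Lemma subsp_add (V : lmodType R[i]) (A B : set V) : subsp A -> subsp B -> subsp (addset A B).
Proof.
move=> sA sB; split.
  by exists 0, 0; rewrite addr0; split=> //; [exact: sA.1|exact: sB.1].
move=> c _ _ [a [b [Aa Bb ->]]] [a' [b' [Aa' Bb' ->]]].
exists (c *: a + a'), (c *: b + b'); split; [exact: sA.2|exact: sB.2|].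
by rewrite scalerDr addrACA.
Qed.

Lemma subsp_image (V W : normedModType R[i]) (T : V -> W) (A : set V) :
  bop T -> subsp A -> subsp (T @` A).
Proof.
move=> bT sA; split; first by exists 0; [exact: sA.1|exact: bop0].
move=> a _ _ [x Ax <-] [y Ay <-]; exists (a *: x + y); first exact: sA.2.
exact: bT.1.
Qed.

Lemma subsp_ker (V : completeNormedModType R[i]) (T : V -> V) :
  bop T -> subsp (opker T).
Proof.
move=> bT; split=> [|a x y]; rewrite /opker /=; first exact: bop0.
by rewrite bT.1 => -> ->; rewrite scaler0 addr0.
Qed.

Section Csub.
Variable X : completeNormedModType R[i].

Definition mkcsub (A : set X) (sA : subsp A) (cA : closed A) : closed_subspace X :=
  ClosedSubspace sA.1 sA.2 cA.

Lemma csub_subsp (M : closed_subspace X) : subsp (csub_set M).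
Proof. by split; [exact: csub0|exact: csubP]. Qed.

Lemma csub_valP (M : closed_subspace X) (u : csub_type M) : csub_set M (csub_val u).
Proof. exact: set_mem (csub_mem u). Qed.

Lemma csub_ex (M : closed_subspace X) x : csub_set M x -> exists u : csub_type M, csub_val u = x.
Proof. by move=> Mx; exists (CSub (mem_set Mx)). Qed.

Lemma csub_val_inj (M : closed_subspace X) : injective (@csub_val R X M).
Proof. exact: val_inj. Qed.

Lemma bop_csub_val (M : closed_subspace X) : bop (@csub_val R X M).
Proof. by split=> //; exists 1 => // x; rewrite mul1r. Qed.

Lemma bop_to_csub (V : normedModType R[i]) (M : closed_subspace X) (S : V -> csub_type M) :
  bop (fun x => csub_val (S x)) -> bop S.
Proof.
move=> [lS [K K0 hK]]; split; last by exists K.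
by move=> a x y; apply: csub_val_inj; rewrite lS.
Qed.

End Csub.

(** Open mapping for [T] viewed as an operator onto the Banach space [range T]. Using the same
    operator for both summands only doubles the constant. *)
Lemma closed_range_liftable (X Y : completeNormedModType R[i]) (T : X -> Y) :
  bop T -> closed (range T) -> exists2 C : R, 0 < C & liftable C T.
Proof.
move=> bT cT; pose M := mkcsub (subsp_image bT (subspT _)) cT.
have Mx x : csub_set M (T x) by exists x.
pose S x : csub_type M := CSub (mem_set (Mx x)).
have bS : bop S by apply: bop_to_csub.
have [|C C0 hC] := open_mapping2 bS bS.
  move=> y; have [x _ xy] := csub_valP y; exists x, 0; rewrite (bop0 bS) addr0.
  by apply: csub_val_inj; rewrite /= xy.
exists (C + C) => [|x]; first exact: addr_gt0.
have [x1 [x2 [h1 h2]]] := hC (S x); rewrite -(bopD bS) => /(congr1 (@csub_val _ _ _)) /= hx.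
exists (x1 + x2) => //; apply: le_trans (rnD _ _) _; rewrite mulrDl; exact: lerD.
Qed.

(** Small increments of an approximating sequence of values have small lifts, so the preimages can
    be corrected into a Cauchy sequence. *)
Lemma liftable_closed (X : completeNormedModType R[i]) (Y : normedModType R[i]) (T : X -> Y) (C : R) :
  bop T -> 0 <= C -> liftable C T -> closed (range T).
Proof.
move=> bT C0 hC; apply/closed_rnP => y hy.
pose P n x := rn (y - T x) <= 2^-1 ^+ n.
pose Q n (x x' : X) := rn (x' - x) <= C * 2 * 2^-1 ^+ n.
have p0 n : 0 < 2^-1 ^+ n :> R by apply: exprn_gt0; lra.
have [a0 [x0 _ xa0] h0] := hy 1 ltr01.
have [||u [u0 hu]] := @dep_choice _ P Q x0.
- by rewrite /P expr0 xa0 ltW.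
- move=> n x hP; have [_ [z _ <-] hz] := hy _ (p0 n.+1).
  have [w Tw hw] := hC (z - x); exists (x + w).
    by rewrite /P (bopD bT) Tw (bopB bT) subrKC ltW.
  rewrite /Q addrC addKr; apply: le_trans hw _; rewrite -mulrA ler_wpM2l //.
  rewrite (bopB bT); apply: le_trans (rn_dist y _ _) _; rewrite rnBC.
  by move: hz hP; rewrite /P exprS; have := p0 n; lra.
have [|n|l hl] := @rn_geometric _ _ u (C * 2); first by rewrite mulr_ge0.
  by have [_] := hu n.
exists l => //; apply/eqP; rewrite eq_sym -subr_eq0; apply/eqP/rn_small0 => e e0.
have [_ [K K0 hK]] := bT.
have [n hn] := half_pow_lt (1 + K * (2 * (C * 2))) e0.
apply/ltW/le_lt_trans/hn; apply: le_trans (rn_dist (T (u n)) _ _) _.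
rewrite mulrDl mul1r; apply: lerD; first by have [] := hu n.
by rewrite -(bopB bT); apply: le_trans (hK _) _; rewrite -[leRHS]mulrA ler_pM2l.
Qed.

(** If [T z] is close to [T x], a short [w] satisfies [T w = T (x - z)]. Then [x - w] differs from
    [z] by a kernel element, hence lies in [Z] close to [x]. *)
Lemma liftable_closed_image (X Y : normedModType R[i]) (T : X -> Y) (C : R) (Z : set X) :
  bop T -> 0 < C -> liftable C T -> closed (range T) -> subsp Z -> closed Z ->
  (forall x, T x = 0 -> Z x) -> closed (T @` Z).
Proof.
move=> bT C0 hC /closed_rnP cT sZ /closed_rnP cZ kZ; apply/closed_rnP => y hy.
have [|x _ Tx] := cT y.
  by move=> e /hy[_ [z _ <-] ?]; exists (T z).
exists x => //; apply: cZ => e e0.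
have [|_ [z Zz <-] hz] := hy (e / C); first by rewrite divr_gt0.
have [w Tw hw] := hC (x - z); exists (x - w).
  rewrite -[_ - _](subrK z); apply: subspD => //; apply: kZ.
  by rewrite !(bopB bT) Tw (bopB bT) addrAC subrr.
rewrite subKr; apply: le_lt_trans hw _; rewrite (bopB bT) Tx mulrC -ltr_pdivlMr //.
Qed.

(** A range with a closed algebraic complement [F] is closed: open mapping for (x, f) |-> [T x + f]
    bounds some solution of [T x = T x1 + f], and there [f] lies in [F] and in the range, so it
    vanishes. *)
Lemma compl_closed_range (X : completeNormedModType R[i]) (T : X -> X) (F : closed_subspace X) :
  bop T -> (forall y, exists x f, csub_set F f /\ y = T x + f) ->
  (forall x, csub_set F (T x) -> T x = 0) -> closed (range T).
Proof.
move=> bT cov dis.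
have [|C C0 hC] := open_mapping2 bT (bop_csub_val F).
  by move=> y; have [x [f [/csub_ex[u <-] ->]]] := cov y; exists x, u.
apply: (liftable_closed bT (ltW C0)) => x.
have [x1 [f [h1 _ h2]]] := hC (T x); exists x1 => //.
apply/eqP; rewrite eq_sym -subr_eq0 -(bopB bT); apply/eqP/dis.
by rewrite (bopB bT) h2 addrAC subrr add0r; exact: csub_valP.
Qed.

End OpenMapping.

(** * Dimension of a subspace modulo another *)

Section Dimension.
Variable R : realType.

Definition catf T n m (e : 'I_n -> T) (f : 'I_m -> T) (i : 'I_(n + m)) : T :=
  match fintype.split i with inl j => e j | inr j => f j end.

Lemma catf_l T n m (e : 'I_n -> T) (f : 'I_m -> T) j : catf e f (lshift m j) = e j.
Proof. by rewrite /catf (unsplitK (inl j)). Qed.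

Lemma catf_r T n m (e : 'I_n -> T) (f : 'I_m -> T) j : catf e f (rshift n j) = f j.
Proof. by rewrite /catf (unsplitK (inr j)). Qed.

Section Fam.
Variable V : lmodType R[i].
Implicit Types A B C : set V.

Definition indep_fam B n (e : 'I_n -> V) : Prop :=
  forall a : 'I_n -> R[i], B (\sum_(j < n) a j *: e j) -> forall j, a j = 0.

Definition indepm A B n : Prop :=
  exists e : 'I_n -> V, (forall j, A (e j)) /\ indep_fam B e.

(* The dimension of A / (A `&` B), for linear subspaces A and B. *)
Definition dimq A B : \bar R := ereal_sup [set n%:R%:E | n in indepm A B].

Lemma indepm0 A B : indepm A B 0.
Proof. by exists (fun=> 0); split=> [[]|a _ []]. Qed.

Lemma indepmW A B n : indepm A B n.+1 -> indepm A B n.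
Proof.
move=> [e [Ae ie]]; exists (fun j => e (widen_ord (leqnSn n) j)); split=> // a Ba j.
pose a' (i : 'I_n.+1) := if insub (nat_of_ord i) is Some j then a j else 0 : R[i].
have a'w i : a' (widen_ord (leqnSn n) i) = a i.
  by rewrite /a' insubT //= => h; congr a; exact: val_inj.
rewrite -a'w; apply: ie; rewrite big_ord_recr /= {2}/a' insubF ?ltnn //=.
by rewrite scale0r addr0; under eq_bigr do rewrite a'w.
Qed.

Lemma indepm_le A B n m : (n <= m)%N -> indepm A B m -> indepm A B n.
Proof. by move=> /subnKC <-; elim: (m - n)%N => [|k IH]; rewrite ?addn0 ?addnS // => /indepmW. Qed.

Lemma dimq_ge A B n : indepm A B n -> (n%:R%:E <= dimq A B)%E.
Proof. by move=> h; apply: ereal_sup_ubound; exists n. Qed.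

Lemma dimq_ge0 A B : (0 <= dimq A B)%E.
Proof. exact: (dimq_ge (@indepm0 A B)). Qed.

Lemma dimq_lt A B n : ~ indepm A B n.+1 -> (dimq A B <= n%:R%:E)%E.
Proof.
move=> h; apply: ge_ereal_sup => _ [k hk <-]; rewrite lee_fin ler_nat leqNgt.
by apply/negP => nk; apply: h; exact: indepm_le hk.
Qed.

Lemma dimq_geP A B n : (n%:R%:E <= dimq A B)%E -> indepm A B n.
Proof.
case: n => [|n] h; first exact: indepm0.
apply: contrapT => /dimq_lt h'; have := le_trans h h'.
by rewrite lee_fin ler_nat ltnn.
Qed.

Lemma dimq_dich A B : (exists n : nat, dimq A B = n%:R%:E) \/ dimq A B = +oo%E.
Proof.
have [h|h] := pselect (forall n, indepm A B n).
  right; apply/eqyP => r r0; apply: le_trans (dimq_ge (h (Num.bound r))).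
  by rewrite lee_fin ltW // archi_boundP // ltW.
left; have /existsNP[k hk] := h; elim: k hk => [|k IH] hk.
  by case: hk; exact: indepm0.
have [hk'|] := pselect (indepm A B k); last exact: IH.
by exists k; apply/eqP; rewrite eq_le dimq_lt //= dimq_ge.
Qed.

(** A maximal independent family spans: in a dependence of the family with [x] appended, the
    coefficient of [x] cannot vanish. *)
Lemma indep_span A B n (e : 'I_n -> V) x :
  subsp B -> (forall j, A (e j)) -> indep_fam B e -> ~ indepm A B n.+1 -> A x ->
  exists a : 'I_n -> R[i], B (x - \sum_(j < n) a j *: e j).
Proof.
move=> sB Ae ie nA Ax; apply: contrapT => no; apply: nA.
exists (fun i : 'I_n.+1 => if insub (nat_of_ord i) is Some j then e j else x).
split=> [i|a]; first by case: insub.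
rewrite big_ord_recr /= [insub n]insubF ?ltnn //.
have -> : \sum_(i < n) a (widen_ord (leqnSn n) i) *:
    (match insub (nat_of_ord i) with Some j => e j | None => x end) =
    \sum_(i < n) a (widen_ord (leqnSn n) i) *: e i.
  apply: eq_bigr => i _; rewrite insubT //= => h.
  by congr (_ *: e _); exact: val_inj.
move=> Bs; have [a0|a0] := eqVneq (a ord_max) 0.
  move: Bs; rewrite a0 scale0r addr0 => /ie h i.
  have [lt|] := ltnP i n.
    by rewrite -[RHS](h (Ordinal lt)); congr a; exact: val_inj.
  move=> ge; rewrite -a0; congr a; apply: val_inj => /=; apply/eqP.
  by rewrite eqn_leq ge -ltnS ltn_ord.
case: no; exists (fun j => - ((a ord_max)^-1 * a (widen_ord (leqnSn n) j))).
have := subspZ sB (a ord_max)^-1 Bs.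
rewrite scalerDr scalerA mulVf // scale1r addrC scaler_sumr -sumrN.
by under eq_bigr do rewrite scalerA; under [in X in _ -> X]eq_bigr do rewrite scaleNr opprK.
Qed.

(** Steinitz bound by rank: if [k > N], the [k] by [N] coefficient matrix has a non-zero left kernel
    vector, which is a dependence modulo [C]. *)
Lemma span_bound A C N k (e : 'I_N -> V) :
  subsp C -> (forall x, A x -> exists a : 'I_N -> R[i], C (x - \sum_(j < N) a j *: e j)) ->
  indepm A C k -> (k <= N)%N.
Proof.
move=> sC sp [g [Ag ig]]; rewrite leqNgt; apply/negP => Nk.
have /choice[P hP] : forall i, exists a : 'I_N -> R[i], C (g i - \sum_(j < N) a j *: e j).
  by move=> i; exact: sp.
pose M := (\matrix_(i < k, j < N) P i j)%R.
have : kermx M != 0.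
  rewrite kermx_eq0 /row_free neq_ltn; apply/orP; left.
  exact: leq_ltn_trans (rank_leq_col _) Nk.
case/rowV0Pn => v /sub_kermxP vM v0.
have v00 : forall j, v 0 j = 0.
  apply: ig; have -> : \sum_(j < k) v 0 j *: g j =
     \sum_(j < k) v 0 j *: (g j - \sum_(l < N) P j l *: e l).
    under [RHS]eq_bigr do rewrite scalerBr.
    rewrite sumrB [X in _ - X](_ : _ = 0) ?subr0 //.
    under eq_bigr do rewrite scaler_sumr.
    rewrite exchange_big /= big1 // => l _.
    under eq_bigr do rewrite scalerA.
    rewrite -scaler_suml (_ : \sum_(j < k) v 0 j * P j l = 0) ?scale0r //.
    have /matrixP/(_ 0 l) := vM; rewrite !mxE => h; rewrite -[RHS]h.
    by apply: eq_bigr => j _; rewrite mxE.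
  by apply: subsp_sum => // j; apply: subspZ.
by case/eqP: v0; apply/rowP => j; rewrite v00 mxE.
Qed.

Lemma indepm_cat A B C n m :
  subsp C -> subsp B -> C `<=` B -> B `<=` A ->
  indepm A B n -> indepm B C m -> indepm A C (n + m).
Proof.
move=> sC sB CB BA [e [Ae ie]] [f [Bf jf]].
exists (catf e f); split=> [i|a]; first by rewrite /catf; case: fintype.split => j //; exact: BA.
rewrite big_split_ord /=.
under eq_bigr do rewrite catf_l; under [X in _ + X]eq_bigr do rewrite catf_r.
move=> Cs; have a0 : forall j, a (lshift m j) = 0.
  apply: ie; apply: subspDr (CB _ Cs) => //.
  by apply: subsp_sum => // j; exact: subspZ.
have b0 : forall j, a (rshift n j) = 0.
  by apply: jf; move: Cs; rewrite big1 ?add0r // => j _; rewrite a0 scale0r.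
by move=> i; case: (split_ordP i) => j ->.
Qed.

(** Concatenated families give one inequality, and infinity when either term is infinite. For finite
    terms, concatenated maximal families span, and [span_bound] gives the other inequality. *)
Lemma dimq_add A B C : subsp C -> subsp B -> C `<=` B -> B `<=` A ->
  dimq A C = (dimq A B + dimq B C)%E.
Proof.
move=> sC sB CB BA.
have infty : (forall n, indepm A C n) -> dimq A C = +oo%E.
  move=> h; have [[n hn]|//] := dimq_dich A C.
  by have := dimq_ge (h n.+1); rewrite hn lee_fin ler_nat ltnn.
have [[n hn]|hn] := dimq_dich A B; last first.
  rewrite hn addye ?infty // => [n|]; last by rewrite gt_eqF // (lt_le_trans _ (dimq_ge0 _ _)) // ltNyr.
  rewrite -[n]addn0; apply: (indepm_cat sC sB) => //; last exact: indepm0.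
  by apply: dimq_geP; rewrite hn leey.
have [[m hm]|hm] := dimq_dich B C; last first.
  rewrite hn hm addey // infty // => m.
  rewrite -[m]add0n; apply: (indepm_cat sC sB) => //; first exact: indepm0.
  by apply: dimq_geP; rewrite hm leey.
have An : indepm A B n by apply: dimq_geP; rewrite hn.
have Bm : indepm B C m by apply: dimq_geP; rewrite hm.
have nA : ~ indepm A B n.+1 by move=> /dimq_ge; rewrite hn lee_fin ler_nat ltnn.
have nB : ~ indepm B C m.+1 by move=> /dimq_ge; rewrite hm lee_fin ler_nat ltnn.
rewrite hn hm -EFinD -natrD; apply/eqP; rewrite eq_le.
rewrite [X in _ && X]dimq_ge ?andbT; last exact: (indepm_cat sC sB).
apply: dimq_lt; case: An => e [Ae ie]; case: Bm => f [Bf jf].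
move=> /(@span_bound _ _ (n + m)%N _ (catf e f) sC) h; suff: ((n + m).+1 <= n + m)%N by rewrite ltnn.
apply: h => x Ax; have [a ha] := indep_span sB Ae ie nA Ax.
have [b hb] := indep_span sC Bf jf nB ha.
exists (catf a b); rewrite big_split_ord /= opprD addrA.
under eq_bigr do rewrite !catf_l; under [X in _ - X]eq_bigr do rewrite !catf_r.
exact: hb.
Qed.

Lemma dimq0_sub A B : subsp B -> dimq A B = 0%E -> A `<=` B.
Proof.
move=> sB d0 x Ax; apply: contrapT => nBx.
suff /dimq_ge : indepm A B 1 by rewrite d0 lee_fin lern0.
exists (fun=> x); split=> // a; rewrite big_ord1 => Ba j.
rewrite ord1; apply: contrapT => /eqP a0; apply: nBx.
by have := subspZ sB (a 0)^-1 Ba; rewrite scalerA mulVf // scale1r.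
Qed.

Lemma dimq_sub0 A B : subsp B -> A `<=` B -> dimq A B = 0%E.
Proof.
move=> sB AB; have h : (dimq A B <= 0%:R%:E)%E.
  apply: dimq_lt => -[e [Ae ie]].
  have/eqP : (1 : R[i]) = 0; last by rewrite oner_eq0.
  by apply: (ie (fun=> 1) _ ord0); rewrite big_ord1; apply: subspZ => //; exact: AB.
by apply/eqP; rewrite eq_le h dimq_ge0.
Qed.

End Fam.

Section Map.
Variables (V W : lmodType R[i]) (f : V -> W).
Hypothesis lf : forall a x y, f (a *: x + y) = a *: f x + f y.

Lemma lin_sum n (a : 'I_n -> R[i]) (e : 'I_n -> V) :
  f (\sum_(j < n) a j *: e j) = \sum_(j < n) a j *: f (e j).
Proof.
have f0 : f 0 = 0.
  by have := lf (-1) 0 0; rewrite scaler0 addr0 => ->; rewrite scaleN1r addNr.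
elim: n a e => [|n IH] a e; first by rewrite !big_ord0.
by rewrite !big_ord_recr /= addrC lf addrC IH.
Qed.

(** The hypotheses make [f] induce an isomorphism of the two quotients; surjectivity is needed only
    modulo [B']. *)
Lemma dimq_iso (A B : set V) (A' B' : set W) :
  subsp A -> subsp B' -> (forall x, A x -> A' (f x)) ->
  (forall y, A' y -> exists2 x, A x & B' (f x - y)) ->
  (forall x, A x -> (B x <-> B' (f x))) ->
  dimq A B = dimq A' B'.
Proof.
move=> sA sB' AA' A'A BB'; rewrite /dimq; congr ereal_sup; congr image.
apply/seteqP; split=> n [e [Ae ie]].
  exists (fun j => f (e j)); split=> [j|a]; first exact: AA'.
  rewrite -lin_sum -BB' => [/ie//|]; apply: subsp_sum => // j; exact: subspZ.
have /choice[x hx] : forall j, exists x, A x /\ B' (f x - e j).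
  by move=> j; have [x ? ?] := A'A _ (Ae j); exists x.
exists x; split=> [j|a]; first by case: (hx j).
rewrite BB'; last by apply: subsp_sum => // j; apply: subspZ => //; case: (hx j).
rewrite lin_sum => Bs; apply: ie.
have -> : \sum_(j < n) a j *: e j =
   \sum_(j < n) a j *: f (x j) - \sum_(j < n) a j *: (f (x j) - e j).
  by rewrite -sumrB; apply: eq_bigr => j _; rewrite -scalerBr subKr.
apply: subspB => //; apply: subsp_sum => // j; apply: subspZ => //.
by case: (hx j).
Qed.

End Map.

Lemma dimq_id (V : lmodType R[i]) (A B A' B' : set V) :
  subsp A -> subsp B' -> A `<=` A' -> (forall y, A' y -> exists2 x, A x & B' (x - y)) ->
  (forall x, A x -> (B x <-> B' x)) -> dimq A B = dimq A' B'.
Proof. by move=> *; apply: (@dimq_iso _ _ id). Qed.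

(** Insert [addset B1 A2] between the two sums: the upper quotient is [A1] modulo [B1] and the lower
    one [A2] modulo [B2]. *)
Lemma dimq_direct (V : lmodType R[i]) (M N A1 B1 A2 B2 : set V) :
  subsp M -> subsp N -> (forall x, M x -> N x -> x = 0) ->
  subsp A1 -> subsp A2 -> subsp B1 -> subsp B2 ->
  A1 `<=` M -> A2 `<=` N -> B1 `<=` A1 -> B2 `<=` A2 ->
  dimq (addset A1 A2) (addset B1 B2) = (dimq A1 B1 + dimq A2 B2)%E.
Proof.
move=> sM sN MN0 sA1 sA2 sB1 sB2 AM AN BA1 BA2.
have uniq (a a' b b' : V) : M a -> M a' -> N b -> N b' -> a + b = a' + b' -> a = a' /\ b = b'.
  move=> Ma Ma' Nb Nb' ab.
  have h : a - a' = b' - b.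
    by apply/eqP; rewrite subr_eq addrAC [b' + a']addrC -ab addrK.
  have h0 : a - a' = 0 by apply: MN0; [exact: subspB|rewrite h; exact: subspB].
  by split; [apply/eqP; rewrite -subr_eq0 h0|apply/eqP; rewrite eq_sym -subr_eq0 -h h0].
rewrite (@dimq_add _ _ (addset B1 A2)); last 4 first.
- exact: subsp_add.
- exact: subsp_add.
- by move=> _ [a [b [? ? ->]]]; exists a, b; split=> //; exact: BA2.
- by move=> _ [a [b [? ? ->]]]; exists a, b; split=> //; exact: BA1.
congr (_ + _)%E; symmetry.
  apply: dimq_id => //; first exact: subsp_add.
  - by move=> x Ax; exists x, 0; rewrite addr0; split=> //; exact: sA2.1.
  - move=> _ [a [b [? ? ->]]]; exists a => //; exists 0, (- b).
    by rewrite add0r opprD addrA subrr add0r; split=> //; [exact: sB1.1|exact: subspN].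
  move=> x Ax; split=> [Bx|[a [b [Ba Ab]]]].
    by exists x, 0; rewrite addr0; split=> //; exact: sA2.1.
  rewrite -[x]addr0 => /uniq[]; [exact: AM|exact/AM/BA1|exact: sN.1|exact: AN|by move=> -> _; rewrite addr0].
apply: dimq_id => //; first exact: subsp_add.
- by move=> x Ax; exists 0, x; rewrite add0r; split=> //; exact: sB1.1.
- move=> _ [a [b [? ? ->]]]; exists b => //; exists (- a), 0.
  rewrite addr0 opprD addrCA subrr addr0; split=> //; [exact: subspN|exact: sB2.1].
move=> x Ax; split=> [Bx|[a [b [Ba Bb]]]].
  by exists 0, x; rewrite add0r; split=> //; exact: sB1.1.
rewrite -[x]add0r => /uniq[]; [exact: sM.1|exact/AM/BA1|exact: AN|exact/AN/BA2|by move=> _ ->; rewrite add0r].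
Qed.

End Dimension.

(** * Riesz's lemma *)

Section Riesz.
Variable R : realType.

Lemma le_Re (z : R[i]) : `|complex.Re z| <= rn z.
Proof. by rewrite -lecR -rnE normc_ge_Re. Qed.

Lemma le_Im (z : R[i]) : `|complex.Im z| <= rn z.
Proof.
rewrite -normrN -ReiNIm; apply: le_trans (le_Re _) _.
by rewrite rnM /rn [X in _ * X](_ : _ = 1) ?mulr1 // normc_def /= expr0n /= add0r expr1n sqrtr1.
Qed.

Lemma real_cauchy (u : nat -> R) :
  (forall e : R, 0 < e -> exists N, forall m n, (N <= m)%N -> (N <= n)%N -> `|u m - u n| < e) ->
  exists l, forall e : R, 0 < e -> exists N, forall n, (N <= n)%N -> `|u n - l| < e.
Proof.
move=> h; have : cvg (u @ \oo).
  apply: cauchy_cvg; apply/cauchyP => e e0.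
  have [N hN] := h _ e0; exists (u N); exists N => // n /= Nn.
  by rewrite -ball_normE /=; apply: hN.
move/cvg_ex => [l /cvgrPdist_lt hl]; exists l => e e0.
have [N _ hN] := hl e e0.
by exists N => n /hN /=; rewrite distrC.
Qed.

(** Completeness of the scalars through real and imaginary parts, needed for the coefficients along
    [g] in [closed_addline]. *)
Lemma complex_cauchy (u : nat -> R[i]) :
  (forall e : R, 0 < e -> exists N, forall m n, (N <= m)%N -> (N <= n)%N -> rn (u m - u n) < e) ->
  exists l, forall e : R, 0 < e -> exists N, forall n, (N <= n)%N -> rn (u n - l) < e.
Proof.
move=> h; have ReB (x y : R[i]) : complex.Re (x - y) = complex.Re x - complex.Re y.
  by case: x y => [? ?] [? ?].
have ImB (x y : R[i]) : complex.Im (x - y) = complex.Im x - complex.Im y.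
  by case: x y => [? ?] [? ?].
have [|p hp] := @real_cauchy (fun n => complex.Re (u n)).
  move=> e /h[N hN]; exists N => m n Nm Nn; rewrite -ReB.
  exact: le_lt_trans (le_Re _) (hN _ _ Nm Nn).
have [|q hq] := @real_cauchy (fun n => complex.Im (u n)).
  move=> e /h[N hN]; exists N => m n Nm Nn; rewrite -ImB.
  exact: le_lt_trans (le_Im _) (hN _ _ Nm Nn).
exists (Complex p q) => e e0; have e2 : 0 < e / 2 by lra.
have [N1 hN1] := hp _ e2; have [N2 hN2] := hq _ e2; exists (maxn N1 N2) => n.
rewrite geq_max => /andP[/hN1 h1 /hN2 h2].
rewrite [X in rn X]complexE; apply: le_lt_trans (rnD _ _) _.
rewrite rnM !rn_real ReB ImB /= [X in X * _](_ : _ = 1) ?mul1r; first lra.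
by rewrite /rn normc_def /= expr0n /= add0r expr1n sqrtr1.
Qed.

Section Closed.
Variable V : normedModType R[i].

Lemma closed_gap (W : set V) g :
  closed W -> ~ W g -> exists2 d : R, 0 < d & forall w, W w -> d <= rn (g - w).
Proof.
move=> /closed_rnP cW nWg; apply: contrapT => no; apply: nWg; apply: cW => e e0.
apply: contrapT => noa; apply: no; exists e => // w Ww; rewrite leNgt; apply/negP => h.
by apply: noa; exists w.
Qed.

Lemma gap_scale (W : set V) g (d : R) : subsp W ->
  (forall w, W w -> d <= rn (g - w)) ->
  forall a w, W w -> d * rn a <= rn (a *: g - w).
Proof.
move=> sW h a w Ww; have [->|a0] := eqVneq a 0; first by rewrite rn0 mulr0 rn_ge0.
rewrite (_ : a *: g - w = a *: (g - a^-1 *: w)).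
  by rewrite rnZ mulrC ler_wpM2l ?rn_ge0 //; apply: h; exact: subspZ.
by rewrite scalerBr scalerA divff // scale1r.
Qed.

Definition addline (W : set V) (g : V) : set V := [set x | exists c, W (x - c *: g)].

Lemma subsp_addline W g : subsp W -> subsp (addline W g).
Proof.
move=> sW; split; first by exists 0; rewrite scale0r subr0; exact: sW.1.
move=> a x y [c hx] [d hy]; exists (a * c + d).
rewrite (_ : _ - _ = a *: (x - c *: g) + (y - d *: g)); first exact: sW.2.
by rewrite scalerDl scalerBr scalerA addrACA opprD.
Qed.

(** The distance [d] from [g] to [W] controls the coefficient of [g]: along an approximating
    sequence these coefficients are Cauchy, and their limit leaves a remainder in the closed set
    [W]. *)
Lemma closed_addline W g : subsp W -> closed W -> closed (addline W g).
Proof.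
move=> sW cW; have [Wg|nWg] := pselect (W g).
  rewrite (_ : addline W g = W) //; apply/seteqP; split=> x.
    by move=> [c] h; rewrite -[x](subrK (c *: g)); apply: subspD => //; exact: subspZ.
  by move=> Wx; exists 0; rewrite scale0r subr0.
have [d d0 /(gap_scale sW) hd] := closed_gap cW nWg.
have cW' := (closed_rnP W).1 cW; apply/closed_rnP => y hy.
have /choice[a ha] : forall n : nat, exists a : R[i],
    exists2 w, W w & rn (y - (a *: g + w)) < 2^-1 ^+ n.
  move=> n; have [|x [c hx] h] := hy (2^-1 ^+ n); first by apply: exprn_gt0; lra.
  by exists c, (x - c *: g) => //; rewrite subrKC.
have [|c hc] := @complex_cauchy a.
  move=> e e0; have [|N hN] := @half_pow_lt R 2 (d * e); first exact: mulr_gt0.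
  exists N => m n Nm Nn; rewrite -(ltr_pM2l d0); apply: le_lt_trans hN.
  have [w Ww hw] := ha m; have [w' Ww' hw'] := ha n.
  apply: le_trans (hd _ (w' - w) _) _; first exact: subspB.
  have -> : (a m - a n) *: g - (w' - w) = (y - (a n *: g + w')) - (y - (a m *: g + w)).
    by rewrite scalerBl !opprB [RHS]addrC subrKA !opprD addrACA.
  apply: le_trans (rnB _ _) _.
  have p k : (N <= k)%N -> 2^-1 ^+ k <= 2^-1 ^+ N :> R.
    by move=> /subnKC <-; rewrite exprD ler_piMr ?exprn_ge0 // exprn_ile1 //; lra.
  by have := p _ Nm; have := p _ Nn; lra.
exists c; apply: cW' => e e0; have e2 : 0 < e / 2 by lra.
have [N1 hN1] := half_pow_lt 1 e2.
have g0 : 0 < rn g + 1 by have := rn_ge0 g; lra.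
have [|N2 hN2] := hc (e / 2 / (rn g + 1)); first by rewrite divr_gt0.
pose n := maxn N1 N2; have [w Ww hw] := ha n; exists w => //.
have -> : y - c *: g - w = (y - (a n *: g + w)) + (a n - c) *: g.
  by rewrite scalerBl opprD [y + (_ + _)]addrA [y - _ *: _ - w]addrAC [in RHS](addrAC y) subrKA.
apply: le_lt_trans (rnD _ _) _; rewrite rnZ.
have h1 : 2^-1 ^+ n <= 2^-1 ^+ N1 :> R.
  by rewrite /n -(subnKC (leq_maxl N1 N2)) exprD ler_piMr ?exprn_ge0 // exprn_ile1 //; lra.
have h2 : rn (a n - c) * rn g <= e / 2.
  have := hN2 _ (leq_maxr N1 N2); rewrite ltr_pdivlMr // => h2.
  by have := rn_ge0 (a n - c); rewrite -/n in h2; lra.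
by move: hN1; rewrite mul1r; lra.
Qed.

Definition addspan (W : set V) n (e : 'I_n -> V) : set V :=
  [set x | exists a : 'I_n -> R[i], W (x - \sum_(j < n) a j *: e j)].

Lemma addspanS W n (e : 'I_n.+1 -> V) :
  addspan W e = addline (addspan W (fun j => e (lift ord0 j))) (e ord0).
Proof.
apply/seteqP; split=> x.
  move=> [a]; rewrite big_ord_recl opprD addrA => h.
  by exists (a ord0), (fun j => a (lift ord0 j)).
move=> [c [a h]]; exists (fun i => if unlift ord0 i is Some j then a j else c).
rewrite big_ord_recl unlift_none opprD addrA.
by under eq_bigr do rewrite liftK.
Qed.

Lemma addspan_subsp_closed W n (e : 'I_n -> V) :
  subsp W -> closed W -> subsp (addspan W e) /\ closed (addspan W e).
Proof.
move=> sW cW; elim: n e => [|n IH] e.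
  suff -> : addspan W e = W by [].
  apply/seteqP; split=> x; first by move=> [a]; rewrite big_ord0 subr0.
  by move=> Wx; exists (fun=> 0); rewrite big_ord0 subr0.
rewrite addspanS; have [? ?] := IH (fun j => e (lift ord0 j)).
by split; [exact: subsp_addline|exact: closed_addline].
Qed.

(** The distance to [W] need not be attained, hence the factor 2. Without such a [w], the distance
    could be halved repeatedly until it fell below the gap. *)
Lemma near_best (W : set V) g : subsp W -> closed W -> ~ W g ->
  exists2 w, W w & forall w', W w' -> rn (g - w) <= 2 * rn (g - w').
Proof.
move=> sW cW nWg; have [d d0 hd] := closed_gap cW nWg.
apply: contrapT => no.
have step (n : nat) w : W w -> exists2 w', W w' & rn (g - w') <= rn (g - w) / 2.
  move=> Ww; apply: contrapT => no'; apply: no; exists w => // w' Ww'.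
  rewrite leNgt; apply/negP => h; apply: no'; exists w' => //; lra.
have [u [u0 hu]] := @dep_choice _ (fun=> W) (fun _ w w' => rn (g - w') <= rn (g - w) / 2) 0 sW.1 step.
have hn n : rn (g - u n) <= rn g * 2^-1 ^+ n.
  elim: n => [|n IH]; first by rewrite u0 subr0 expr0 mulr1.
  by have [_] := hu n; rewrite exprS; lra.
have [N hN] := half_pow_lt (rn g) d0.
by have [/hd h _] := hu N; have := hn N; lra.
Qed.

(* The constant 3^-m depends on m only; this uniformity is what makes nullity and
   deficiency locally constant with a radius independent of the base point. *)
Lemma riesz (W A : set V) m : subsp W -> closed W -> subsp A -> W `<=` A -> indepm A W m ->
  exists e : 'I_m -> V, (forall j, A (e j) /\ rn (e j) <= 1) /\
    forall (a : 'I_m -> R[i]) w, W w ->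
      forall j, 3^-1 ^+ m * rn (a j) <= rn (\sum_(j < m) a j *: e j - w).
Proof.
move=> sW cW sA WA; elim: m => [|m IH] hm.
  by exists (fun=> 0); split=> [[]|a w _ []].
have [e [Ae he]] := IH (indepmW hm).
have [sW' cW'] := addspan_subsp_closed e sW cW.
have [g Ag nWg] : exists2 g, A g & ~ addspan W e g.
  apply: contrapT => no; suff: (m.+1 <= m)%N by rewrite ltnn.
  apply: (span_bound sW (e := e)) hm => x Ax; apply: contrapT => h.
  by apply: no; exists x.
have [w0 Ww0 hw0] := near_best sW' cW' nWg.
have gw0 : g - w0 != 0.
  by apply/eqP => /eqP; rewrite subr_eq0 => /eqP gw; apply: nWg; rewrite gw.
have r0 := rn_gt0 gw0; set r := rn (g - w0) in r0 hw0.
have rC0 : r%:C != 0 by rewrite (inj_eq (@complexI _) r 0) gt_eqF.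
(* A unit vector at distance at least one half from the span of [W] and the previous vectors. *)
pose g1 := r%:C^-1 *: (g - w0).
have hg1 a w : addspan W e w -> 2^-1 * rn a <= rn (a *: g1 - w).
  apply: gap_scale => // {}w Ww.
  have := hw0 (w0 + r%:C *: w); rewrite -/r => h.
  have {}h : r <= 2 * rn (g - (w0 + r%:C *: w)).
    by apply: h; apply: subspD => //; exact: subspZ.
  have -> : g1 - w = r%:C^-1 *: (g - (w0 + r%:C *: w)).
    by rewrite opprD addrA scalerBr scalerA mulVf // scale1r.
  by rewrite rnZ rnV rn_real gtr0_norm // ler_pdivlMl //; lra.
have Aw0 : A w0.
  case: Ww0 => a /WA h; rewrite -[w0](subrK (\sum_(j < m) a j *: e j)).
  by apply: subspD => //; apply: subsp_sum => // j; apply: subspZ => //; case: (Ae j).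
exists (fun i => if unlift ord0 i is Some j then e j else g1); split=> [i|a w Ww i].
  case: unliftP => [j _|_]; first exact: Ae.
  split; first by apply: subspZ => //; exact: subspB.
  by rewrite rnZ rnV rn_real gtr0_norm // mulVf // gt_eqF.
rewrite big_ord_recl unlift_none.
under eq_bigr do rewrite liftK.
set s := \sum_(j < m) _; set N := rn (_ - w).
have p3 : 0 <= 3^-1 ^+ m :> R by rewrite exprn_ge0 //; lra.
have p3' : 3^-1 ^+ m <= 1 :> R by rewrite exprn_ile1 //; lra.
(* Origin of the factor 3: the new coefficient is at most [2 * N], so removing its term leaves a
   vector of norm at most [N + 2 * N], to which the induction hypothesis applies. *)
have h0 : 2^-1 * rn (a ord0) <= N.
  rewrite /N -addrA -[s - w]opprB; apply: hg1.
  by exists (fun j => - a (lift ord0 j)); under eq_bigr do rewrite scaleNr;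
    rewrite sumrN opprK -/s subrK.
rewrite exprS; case: (unliftP ord0 i) => [j ->|->]; last first.
  have := rn_ge0 (a ord0).
  have : 3^-1 ^+ m * rn (a ord0) <= 1 * rn (a ord0) by rewrite ler_wpM2r ?rn_ge0.
  lra.
have hj := he (fun j => a (lift ord0 j)) w Ww j.
rewrite -/s in hj.
have : rn (s - w) <= N + rn (a ord0 *: g1).
  rewrite (_ : s - w = a ord0 *: g1 + s - w - a ord0 *: g1); first exact: rnB.
  by rewrite addrAC; congr (_ - _); rewrite addrAC subrr add0r.
have : rn (a ord0 *: g1) <= rn (a ord0).
  by rewrite rnZ rnZ rnV rn_real gtr0_norm // mulVf ?mulr1 // gt_eqF.
lra.
Qed.

End Closed.
End Riesz.

(** * Perturbation of Kato operators *)

Section KatoPerturbation.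
Variable R : realType.

Section Stability.
Variable X : completeNormedModType R[i].

Lemma sum_bound m (p s q : R) (r : 'I_m -> R) :
  (forall j, 0 <= r j) -> (forall j, p * r j <= q * \sum_(j < m) r j) -> m%:R * q < p ->
  forall j, r j = 0.
Proof.
move=> r0 h mqp; suff s0 : \sum_(j < m) r j <= 0.
  move=> j; apply/eqP; rewrite eq_le r0 andbT; apply: le_trans s0.
  by rewrite (bigD1 j) //= ler_wpDr // sumr_ge0.
have : p * \sum_(j < m) r j <= m%:R * q * \sum_(j < m) r j.
  rewrite mulr_sumr; apply: le_trans (ler_sum _ (fun j _ => h j)) _.
  by rewrite sumr_const card_ord -[leLHS]mulr_natl mulrA.
by rewrite -subr_ge0 -mulrBl nmulr_rge0 // subr_lt0.
Qed.

(** Each normalized kernel vector [e j] of [S] is corrected by a short [x j] with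
    [S' (x j) = S' (e j)]. A dependence among the [e j - x j] would equate a combination of the
    [e j] with a much shorter one of the [x j], against the Riesz bound. *)
Lemma indepm_ker_stable (S S' : X -> X) (C d : R) m :
  bop S -> bop S' -> 0 <= C -> liftable C S' -> (forall x, rn (S x - S' x) <= d * rn x) -> 0 <= d ->
  m%:R * (C * d) < 3^-1 ^+ m ->
  indepm (opker S) [set 0] m -> indepm (opker S') [set 0] m.
Proof.
move=> bS bS' C0 hC hd d0 small hm.
have [||e [Se he]] := riesz (@subsp0 R X) _ (subsp_ker bS) _ hm.
- apply/closed_rnP => x h; apply/rn_small0 => e /h[_ -> ].
  by rewrite subr0 => /ltW.
- by move=> _ ->; exact: (bop0 bS).
have /choice[x hx] : forall j, exists x, S' x = S' (e j) /\ rn x <= C * d.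
  move=> j; have [x h1 h2] := hC (e j); exists x; split=> //.
  apply: le_trans h2 _; rewrite ler_wpM2l //.
  have [Sj e1] := Se j; have := hd (e j); rewrite Sj sub0r rnN => h.
  by apply: le_trans h _; rewrite ler_piMr.
exists (fun j => e j - x j); split=> [j|a ha].
  by rewrite /opker /= (bopB bS'); case: (hx j) => -> _; rewrite subrr.
suff h j : rn (a j) = 0 by move=> j; exact/rn_eq0.
move: j; apply: (@sum_bound m (3^-1 ^+ m) 0 (C * d)) => // [j|j]; first exact: rn_ge0.
apply: le_trans (he a 0 _ j) _ => //; rewrite subr0.
have -> : \sum_(j < m) a j *: e j = \sum_(j < m) a j *: x j.
  apply/eqP; rewrite -subr_eq0 -sumrB; apply/eqP; rewrite -[RHS]ha.
  by apply: eq_bigr => k _; rewrite scalerBr.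
apply: le_trans (rn_sum _) _; rewrite mulr_sumr; apply: ler_sum => k _.
by rewrite rnZ mulrC ler_wpM2r ?rn_ge0 //; case: (hx k).
Qed.

(** If a combination of the Riesz vectors were [S' x] with [x] a short lift, [S x] would be closer
    to that combination than the Riesz bound modulo [range S] allows. *)
Lemma indepm_range_stable (S S' : X -> X) (C d : R) m :
  bop S -> bop S' -> 0 <= C -> liftable C S' -> closed (range S) ->
  (forall x, rn (S x - S' x) <= d * rn x) -> 0 <= d ->
  m%:R * (C * d) < 3^-1 ^+ m ->
  indepm setT (range S) m -> indepm setT (range S') m.
Proof.
move=> bS bS' C0 hC cS hd d0 small hm.
have sR := subsp_image bS (@subspT R X).
have [//|e [Se he]] := riesz sR cS (@subspT R X) _ hm.
exists e; split=> // a [x0 _ hx0].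
have [x hx1 hx2] := hC x0; rewrite hx0 in hx1 hx2.
suff h j : rn (a j) = 0 by move=> j; exact/rn_eq0.
move: j; apply: (@sum_bound m (3^-1 ^+ m) 0 (C * d)) => // [j|j]; first exact: rn_ge0.
apply: le_trans (he a (S x) _ j) _ => //.
rewrite -hx1 rnBC; apply: le_trans (hd _) _.
rewrite [C * d]mulrC -mulrA ler_wpM2l //; apply: le_trans hx2 _; rewrite ler_wpM2l //.
apply: le_trans (rn_sum _) _; apply: ler_sum => k _.
by rewrite rnZ ler_piMr ?rn_ge0 //; case: (Se k).
Qed.

(** The segment from [mu] to [nu] stays in the disc by convexity and is cut into [N] steps shorter
    than [eta]. *)
Lemma disc_chain (P : R[i] -> Prop) (eps eta : R) mu nu :
  0 < eta ->
  (forall m n, rn m < eps -> rn n < eps -> rn (m - n) < eta -> P m -> P n) ->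
  rn mu < eps -> rn nu < eps -> P mu -> P nu.
Proof.
move=> eta0 step hmu hnu Pmu.
pose N := Num.bound (rn (nu - mu) / eta).
have hN : rn (nu - mu) / eta < N%:R.
  by apply: archi_boundP; rewrite divr_ge0 ?rn_ge0 // ltW.
have N0 : 0 < N%:R :> R by apply: le_lt_trans hN; rewrite divr_ge0 ?rn_ge0 // ltW.
pose z (k : nat) : R[i] := mu + (k%:R / N%:R : R)%:C * (nu - mu).
have zin k : (k <= N)%N -> rn (z k) < eps.
  move=> kN; have -> : z k = (1 - k%:R / N%:R : R)%:C * mu + (k%:R / N%:R : R)%:C * nu.
    by rewrite /z rmorphB rmorph1; ring.
  have t0 : 0 <= k%:R / N%:R :> R by rewrite divr_ge0.
  have t1 : k%:R / N%:R <= 1 :> R by rewrite ler_pdivrMr // mul1r ler_nat.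
  apply: le_lt_trans (rnD _ _) _; rewrite !rnM !rn_real !ger0_norm ?subr_ge0 //.
  move: t0 t1; set t := _ / _ => t0 t1.
  have : (1 - t) * rn mu <= (1 - t) * Num.max (rn mu) (rn nu).
    by rewrite ler_wpM2l ?subr_ge0 // le_max lexx.
  have : t * rn nu <= t * Num.max (rn mu) (rn nu).
    by rewrite ler_wpM2l // le_max lexx orbT.
  have : Num.max (rn mu) (rn nu) < eps by rewrite gt_max hmu hnu.
  lra.
have Pz k : (k <= N)%N -> P (z k).
  elim: k => [|k IH] kN; first by rewrite /z mul0r mul0r addr0.
  apply: (step (z k)); [exact/zin/ltnW|exact: zin| |exact/IH/ltnW].
  have -> : z k - z k.+1 = - ((N%:R^-1 : R)%:C * (nu - mu)).
    rewrite /z; have -> : (k.+1%:R / N%:R : R) = k%:R / N%:R + N%:R^-1.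
      by rewrite -natr1 mulrDl mul1r.
    by rewrite rmorphD; ring.
  rewrite rnN rnM rn_real gtr0_norm ?invr_gt0 // ltr_pdivrMl //.
  by move: hN; rewrite ltr_pdivrMr.
have := Pz N (leqnn _); rewrite /z divff ?gt_eqF // rmorph1 mul1r.
by rewrite subrKC.
Qed.

End Stability.

Section Kato.
Variable X : completeNormedModType R[i].
Variable T : X -> X.
Hypotheses (bT : bop T) (kT : Kato T).

(** Each range of a power contains the kernel, so [liftable_closed_image] applies at every step. *)
Lemma Kato_closed_iter n : closed (range (iter n T)).
Proof.
have [C C0 hC] := closed_range_liftable bT kT.1.
elim: n => [|n IH]; first by rewrite (_ : range _ = setT) ?image_id //; exact: closedT.
rewrite (_ : range _ = T @` range (iter n T)).
  apply: (liftable_closed_image bT C0 hC kT.1) => //.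
    by apply: subsp_image; [exact: bop_iter|exact: subspT].
  by move=> x Tx; apply: kT.2.
by rewrite image_comp.
Qed.

(* A Kato operator T maps this closed subspace onto itself and is bounded below
   modulo it; both properties survive a small scalar shift. *)
Definition hyper_range : set X := [set x | forall n, range (iter n T) x].
Local Notation Z := hyper_range.

Lemma hyper_subsp : subsp Z.
Proof.
have s n : subsp (range (iter n T)).
  by apply: subsp_image; [exact: bop_iter|exact: subspT].
split=> [n|a x y hx hy n]; first exact: (s n).1.
exact: (s n).2.
Qed.

Lemma hyper_closed : closed Z.
Proof.
apply/closed_rnP => x hx n; have /closed_rnP := @Kato_closed_iter n; apply.
by move=> e /hx[a Za ?]; exists a.
Qed.

Lemma hyper_ker x : T x = 0 -> Z x.
Proof. by move=> h n; apply: kT.2. Qed.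

Lemma hyper_fwd x : Z x -> Z (T x).
Proof. by move=> Zx n; have [y _ <-] := Zx n; exists (T y) => //; rewrite -iterSr. Qed.

(** If [T x] is [T] applied to an element of [range (iter n T)], then [x] differs from that element
    by a kernel vector, which lies in [Z]. *)
Lemma hyper_bwd x : Z (T x) -> Z x.
Proof.
move=> ZTx n; have [y _ hy] := ZTx n.+1.
have : Z (x - iter n T y) by apply: hyper_ker; rewrite (bopB bT) -hy subrr.
have s : subsp (range (iter n T)) by apply: subsp_image; [exact: bop_iter|exact: subspT].
move=> /(_ n) h; rewrite -[x](subrK (iter n T y)); apply: subspD => //.
Qed.

Lemma hyper_pre z : Z z -> exists2 x, Z x & T x = z.
Proof. by move=> Zz; have [x _ /= hx] := Zz 1%N; exists x => //; apply: hyper_bwd; rewrite hx. Qed.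

(** A lift of [S x] is built from two estimates: [S] maps [Z] onto itself with constant [2 * C], and
    the distance from [x] to [Z] is at most a multiple of [rn (S x)]. The kernel of [S] lies in [Z],
    and [Z] lies in the range of every power of [S]. *)
Lemma kato_shift : exists2 eps : R, 0 < eps & exists2 C : R, 0 < C &
  forall mu, rn mu < eps -> liftable C (opshift T mu) /\ Kato (opshift T mu).
Proof.
have [C C0 hC] := closed_range_liftable bT kT.1.
have [_ [K K0 hK]] := bT.
pose L := K + (2 * C)^-1.
have L0 : 0 < L by rewrite addr_gt0 // invr_gt0 mulr_gt0.
exists (2 * C)^-1; first by rewrite invr_gt0 mulr_gt0.
(* A point of [Z] lies within [3 * C * rn (S x)] of [x], and its image is lifted inside [Z] at the
   cost of [2 * C * (1 + 3 * L * C) * rn (S x)]. The bound [L] serves all shifts in the disc, so the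
   constant is independent of [mu]. *)
exists (5 * C + 6 * C * L * C); first by rewrite addr_gt0 // !mulr_gt0.
move=> mu hmu; pose S := opshift T mu; have bS : bop S by exact: bop_opshift.
have hCmu : C * rn mu <= 2^-1.
  have : C * rn mu <= C * (2 * C)^-1 by rewrite ler_pM2l // ltW.
  by rewrite invfM mulrCA divff ?gt_eqF // mulr1.
have hL x : rn (S x) <= L * rn x.
  apply: le_trans (rnB _ _) _; rewrite mulrDl rnZ; apply: lerD => //.
  by rewrite ler_wpM2r ?rn_ge0 // ltW.
have SZ x : Z x -> Z (S x).
  move=> Zx; apply: (subspB hyper_subsp); first exact: hyper_fwd.
  exact: (subspZ hyper_subsp).
(* A lift [x] of [z] under [T] leaves the residual [mu *: x], of norm at most half that of [z], so
   successive approximation runs inside [Z]; the second source operator is zero. *)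
have solve z : Z z -> exists x, [/\ Z x, S x = z & rn x <= 2 * C * rn z].
  pose M := mkcsub hyper_subsp hyper_closed.
  have iS : invariant_sub S M by move=> x; exact: SZ.
  have b1 : bop (restr iS).
    by apply: bop_to_csub; exact: (bop_comp (bop_csub_val M) bS).
  have b2 : bop (fun _ : csub_type M => 0 : csub_type M).
    split=> [a x y|]; first by rewrite scaler0 addr0.
    by exists 1 => // x; rewrite rn0 mul1r rn_ge0.
  have step (y : csub_type M) : exists x1 x2 : csub_type M,
     [/\ rn x1 <= C * rn y, rn x2 <= C * rn y & rn (y - (restr iS x1 + 0)) <= rn y / 2].
    have [x0 Zx0 hx0] := hyper_pre (csub_valP y).
    have [x hx1 hx2] := hC x0.
    have [u hu] : exists u : csub_type M, csub_val u = x.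
      by apply: csub_ex; apply: hyper_bwd; rewrite hx1 hx0; exact: (csub_valP y).
    exists u, 0; split; last 1 first.
    - rewrite addr0; change (rn (csub_val y - S (csub_val u)) <= rn (csub_val y) / 2).
      rewrite hu /S opshiftE hx1 hx0 subKr rnZ.
      apply: (@le_trans _ _ (rn mu * (C * rn (csub_val y)))).
        by rewrite ler_wpM2l ?rn_ge0 // -hx0.
      by rewrite mulrA mulrC ler_wpM2l ?rn_ge0 // mulrC.
    - by change (rn (csub_val u) <= C * rn (csub_val y)); rewrite hu -hx0.
    by rewrite rn0 mulr_ge0 ?rn_ge0 // ltW.
  move=> Zz; have [y hy] := csub_ex (M := M) Zz.
  have [x1 [x2 [h1 _ h2]]] := approx_solve b1 b2 (ltW C0) step y.
  exists (csub_val x1); split; first exact: (csub_valP x1).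
    by rewrite -hy h2 addr0.
  by rewrite -hy.
(* The new approximant [x - w] is chosen with [T (x - w) = mu *: z0], which puts it in [Z]; the
   length of [w] is governed by [S x + mu *: (x - z0)]. *)
have near1 x z0 : Z z0 -> exists2 z1, Z z1 & rn (x - z1) <= C * rn (S x) + rn (x - z0) / 2.
  move=> Zz0; have [v Zv hv] := hyper_pre (subspZ hyper_subsp mu Zz0).
  have [w hw1 hw2] := hC (x - v).
  exists (x - w).
    by apply: hyper_bwd; rewrite (bopB bT) hw1 (bopB bT) subKr; exact: hyper_fwd.
  rewrite subKr; apply: le_trans hw2 _; rewrite (bopB bT) hv.
  have -> : T x - mu *: z0 = S x + mu *: (x - z0).
    by rewrite /S opshiftE scalerBr addrA subrK.
  apply: le_trans (_ : C * (rn (S x) + rn mu * rn (x - z0)) <= _).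
    by rewrite ler_pM2l // -rnZ; exact: rnD.
  rewrite mulrDr lerD2l mulrA [_ / 2]mulrC ler_wpM2r ?rn_ge0 //.
(* For [mu != 0] the kernel consists of eigenvectors, which are multiples of their images under
   every power of [T]. *)
have kerZ x : S x = 0 -> Z x.
  move/eqP; rewrite /S opshiftE subr_eq0 => /eqP hx.
  have [mu0|mu0] := eqVneq mu 0; first by apply: hyper_ker; rewrite hx mu0 scale0r.
  move=> n; exists ((mu ^+ n)^-1 *: x) => //.
  have -> : iter n T ((mu ^+ n)^-1 *: x) = (mu ^+ n)^-1 *: iter n T x.
    by rewrite (bopZ (bop_iter n bT)).
  have -> : iter n T x = mu ^+ n *: x.
    elim: n => [|n IH]; first by rewrite expr0 scale1r.
    by rewrite iterS IH (bopZ bT) hx scalerA exprSr.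
  by rewrite scalerA mulVf ?scale1r // expf_neq0.
have oS : liftable (5 * C + 6 * C * L * C) S.
  move=> x; have [Sx0|Sx0] := eqVneq (S x) 0.
    by exists 0; rewrite ?(bop0 bS) ?Sx0 // rn0 mulr0.
  have y0 := rn_gt0 Sx0.
  have [u [u0 hu]] := @dep_choice _ (fun=> Z)
    (fun _ z z' => rn (x - z') <= C * rn (S x) + rn (x - z) / 2) 0 hyper_subsp.1
    (fun _ z => @near1 x z).
  have hn n : rn (x - u n) <= 2 * C * rn (S x) + rn x * 2^-1 ^+ n.
    elim: n => [|n IH].
      by rewrite u0 subr0 expr0 mulr1 lerDr !mulr_ge0 // ltW.
    by have [_] := hu n; rewrite exprS; lra.
  have [N hN] := half_pow_lt (rn x) (mulr_gt0 C0 y0).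
  have [ZuN _] := hu N.
  have [w [Zw Sw hw]] := solve _ (SZ _ ZuN).
  exists (x - u N + w); first by rewrite (bopD bS) (bopB bS) Sw subrK.
  have h3 : rn (x - u N) <= 3 * C * rn (S x) by have := hn N; lra.
  have h4 : rn (S (u N)) <= rn (S x) + L * (3 * C * rn (S x)).
    rewrite -[u N](subKr x) (bopB bS); apply: le_trans (rnB _ _) _.
    by rewrite lerD2l; apply: le_trans (hL _) _; rewrite ler_pM2l.
  have h5 : rn w <= 2 * C * (rn (S x) + L * (3 * C * rn (S x))).
    by apply: le_trans hw _; rewrite ler_pM2l // mulr_gt0.
  by apply: le_trans (rnD _ _) _; lra.
split=> //; split.
  by apply: liftable_closed oS => //; rewrite addr_ge0 // !mulr_ge0 // ltW.
move=> n x /kerZ; elim: n x => [|n IH] x Zx; first by exists x.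
have [y [Zy Sy _]] := solve _ Zx; have [w _ hw] := IH _ Zy.
by exists w => //=; rewrite hw.
Qed.

(** The constant [C] is common to the whole disc, so for each number [k] of vectors the step [eta]
    is uniform there and [disc_chain] applies. Perturbing only around 0 would give a radius
    depending on [k]. *)
Lemma kato_dims : exists2 eps : R, 0 < eps & forall mu, rn mu < eps ->
  [/\ Kato (opshift T mu),
      dimq (opker (opshift T mu)) [set 0] = dimq (opker T) [set 0] &
      dimq setT (range (opshift T mu)) = dimq setT (range T)].
Proof.
have [eps eps0 [C C0 hK]] := kato_shift; exists eps => // mu hmu.
have T0 : opshift T 0 = T by apply/funext => x; rewrite opshiftE scale0r subr0.
have z0 : rn (0 : R[i]) < eps by rewrite rn0.
have dist m n x : rn (opshift T m x - opshift T n x) <= rn (m - n) * rn x.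
  by rewrite !opshiftE opprB addrC subrKA -scalerBl rnZ rnBC.
have kerS k m n : rn m < eps -> rn n < eps ->
    indepm (opker (opshift T m)) [set 0] k -> indepm (opker (opshift T n)) [set 0] k.
  (* Makes [k * (C * eta)] smaller than the Riesz constant; the added 1 avoids a zero denominator at
     [k = 0]. *)
  pose eta : R := 3^-1 ^+ k / ((k%:R + 1) * C).
  have eta0 : 0 < eta by rewrite divr_gt0 ?exprn_gt0 // mulr_gt0 // ltr_wpDl.
  apply: (@disc_chain (fun m => indepm (opker (opshift T m)) [set 0] k) eps eta) => //.
  move=> {}m {}n hm hn; rewrite ltr_pdivlMr ?mulr_gt0 // ?ltr_wpDl // => hmn.
  apply: (@indepm_ker_stable _ _ _ C (rn (m - n))) => //; try exact: bop_opshift.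
  - exact: ltW.
  - exact: (hK _ hn).1.
  - exact: rn_ge0.
  - by have := mulr_ge0 (ltW C0) (rn_ge0 (m - n)); lra.
have ranS k m n : rn m < eps -> rn n < eps ->
    indepm setT (range (opshift T m)) k -> indepm setT (range (opshift T n)) k.
  pose eta : R := 3^-1 ^+ k / ((k%:R + 1) * C).
  have eta0 : 0 < eta by rewrite divr_gt0 ?exprn_gt0 // mulr_gt0 // ltr_wpDl.
  apply: (@disc_chain (fun m => indepm setT (range (opshift T m)) k) eps eta) => //.
  move=> {}m {}n hm hn; rewrite ltr_pdivlMr ?mulr_gt0 // ?ltr_wpDl // => hmn.
  apply: (@indepm_range_stable _ _ _ C (rn (m - n))) => //; try exact: bop_opshift.
  - exact: ltW.
  - exact: (hK _ hn).1.
  - exact: (hK _ hm).2.1.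
  - exact: rn_ge0.
  - by have := mulr_ge0 (ltW C0) (rn_ge0 (m - n)); lra.
split; first exact: (hK _ hmu).2.
- have -> : opker T = opker (opshift T 0) by rewrite T0.
  rewrite /dimq; congr ereal_sup; congr image; apply/seteqP.
  by split=> k; exact: kerS.
have -> : range T = range (opshift T 0) by rewrite T0.
rewrite /dimq; congr ereal_sup; congr image; apply/seteqP.
by split=> k; exact: ranS.
Qed.

End Kato.
End KatoPerturbation.

(** * Restriction to the range of a power *)

Section SemiFredholm.
Variable R : realType.

Section Restriction.
Variable X : completeNormedModType R[i].
Variables (T : X -> X) (M : closed_subspace X) (TM : invariant_sub T M).

Lemma bop_restr : bop T -> bop (restr TM).
Proof. by move=> bT; apply: bop_to_csub; exact: (bop_comp (bop_csub_val M) bT). Qed.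

Lemma val_iter_restr n u : csub_val (iter n (restr TM) u) = iter n T (csub_val u).
Proof. by elim: n => //= n ->. Qed.

Lemma csub_val_image n :
  @csub_val R X M @` range (iter n (restr TM)) = iter n T @` csub_set M.
Proof.
apply/seteqP; split=> x.
  by move=> [_ [u _ <-] <-]; exists (csub_val u); [exact: csub_valP|rewrite val_iter_restr].
move=> [y /csub_ex[u <-] <-]; exists (iter n (restr TM) u); first by exists u.
exact: val_iter_restr.
Qed.

Lemma restr_opshift m (SM : invariant_sub (opshift T m) M) :
  opshift (restr TM) m = restr SM.
Proof. by apply/funext => u; apply: csub_val_inj. Qed.

End Restriction.

Lemma invariant_opshift (X : completeNormedModType R[i]) (T : X -> X) (M : closed_subspace X) m :
  invariant_sub T M -> invariant_sub (opshift T m) M.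
Proof.
move=> TM x Mx; apply: (subspB (csub_subsp M)); first exact: TM.
exact: (subspZ (csub_subsp M)).
Qed.

Section CsubTransfer.
Variable X : completeNormedModType R[i].
Variable M : closed_subspace X.

Lemma closed_csub_preimage (A : set X) : closed A -> closed (@csub_val R X M @^-1` A).
Proof.
move=> /closed_rnP cA; apply/closed_rnP => u hu; apply: cA => e /hu[v Av ?].
by exists (csub_val v).
Qed.

Lemma closed_csub_image (A : set (csub_type M)) :
  closed A -> closed (@csub_val R X M @` A).
Proof.
move=> /closed_rnP cA; apply/closed_rnP => x hx.
have /csub_ex[u ux] : csub_set M x.
  have /closed_rnP := @csub_closed _ _ M; apply=> e /hx[_ [v _ <-] ?].
  by exists (csub_val v) => //; exact: csub_valP.
exists u => //; apply: cA => e /hx[_ [v Av <-]]; rewrite -ux => ?.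
by exists v.
Qed.

Lemma dimq_csub (A B : set (csub_type M)) : subsp A -> subsp B ->
  dimq A B = dimq (@csub_val R X M @` A) (@csub_val R X M @` B).
Proof.
move=> sA sB; apply: (dimq_iso (f := @csub_val R X M)) => //.
- exact: (subsp_image (bop_csub_val M)).
- move=> _ [x Ax <-]; exists x => //; exists 0; first exact: sB.1.
  by rewrite subrr.
by move=> x _; split=> [Bx|[y By /csub_val_inj <-]//]; exists x.
Qed.

End CsubTransfer.

Lemma ker_restr (X : completeNormedModType R[i]) (T : X -> X) (M : closed_subspace X)
    (TM : invariant_sub T M) :
  @csub_val R X M @` opker (restr TM) = opker T `&` csub_set M.
Proof.
apply/seteqP; split=> x.
  move=> [u /(congr1 (@csub_val _ _ _)) /= h <-]; split=> //; exact: csub_valP.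
by move=> [Tx /csub_ex[u ux]]; exists u => //; apply: csub_val_inj; rewrite /= ux.
Qed.

Lemma csub_val_setT (X : completeNormedModType R[i]) (M : closed_subspace X) :
  range (@csub_val R X M) = csub_set M.
Proof.
apply/seteqP; split=> x; first by move=> [u _ <-]; exact: csub_valP.
by move=> /csub_ex[u]; exists u.
Qed.

Lemma range_restr (X : completeNormedModType R[i]) (T : X -> X) (M : closed_subspace X)
    (TM : invariant_sub T M) :
  @csub_val R X M @` range (restr TM) = T @` csub_set M.
Proof. exact: (csub_val_image TM 1). Qed.

Lemma dim_ker_restr (X : completeNormedModType R[i]) (T : X -> X) (M : closed_subspace X)
    (TM : invariant_sub T M) : bop T ->
  dimq (opker (restr TM)) [set 0] = dimq (opker T `&` csub_set M) [set 0].
Proof.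
move=> bT; rewrite dimq_csub ?ker_restr ?image_set1 //; last exact: subsp0.
exact: subsp_ker (bop_restr TM bT).
Qed.

Lemma codim_restr (X : completeNormedModType R[i]) (T : X -> X) (M : closed_subspace X)
    (TM : invariant_sub T M) : bop T ->
  dimq setT (range (restr TM)) = dimq (csub_set M) (T @` csub_set M).
Proof.
move=> bT; rewrite dimq_csub ?range_restr ?csub_val_setT //.
exact: subsp_image (bop_restr TM bT) (subspT _).
Qed.

Section Chain.
Variable X : completeNormedModType R[i].
Variable T : X -> X.
Hypothesis bT : bop T.

(** The loss of nullity when [A] is replaced by [T @] A[. It vanishes exactly when the part of the
    kernel in]A[already lies in]T @[A], which for ranges of powers leads to the Kato condition. *)
Definition jump (A : set X) : \bar R := dimq (opker T `&` A) (opker T `&` T @` A).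

(* The summand removed from the nullity and from the deficiency is the same, which
   expresses the invariance of the index without subtracting infinities. *)
Lemma one_step (A : set X) : subsp A -> T @` A `<=` A ->
  dimq (opker T `&` A) [set 0%R] = (jump A + dimq (opker T `&` T @` A) [set 0%R])%E /\
  dimq A (T @` A) = (jump A + dimq (T @` A) (T @` (T @` A)))%E.
Proof.
move=> sA TA; have sK := subsp_ker bT.
have sTA := subsp_image bT sA.
have sKA := subspI sK sA; have sKTA := subspI sK sTA.
split.
  apply: dimq_add => //; first exact: subsp0.
    by move=> _ ->; exact: sKTA.1.
  by move=> x [? ?]; split=> //; exact: TA.
have sS := subsp_add sTA sKA.
(* [T] identifies the quotient of [A] by this sum with that of [T @]
   A[by its image; the sum modulo]T @[A] is the jump. *)
rewrite (@dimq_add _ _ _ (addset (T @` A) (opker T `&` A))) //; last 2 first.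
- by move=> x TAx; exists x, 0; rewrite addr0; split=> //; exact: sKA.1.
- by move=> _ [x [y [/TA Ax [_ Ay] ->]]]; exact: subspD.
rewrite addeC; congr (_ + _)%E.
  symmetry; apply: dimq_id => //.
  - by move=> x KAx; exists 0, x; rewrite add0r; split=> //; exact: sTA.1.
  - move=> _ [x [y [TAx KAy ->]]]; exists y => //.
    by rewrite opprD addrCA subrr addr0; exact: subspN.
  by move=> x [Kx Ax]; split=> [[]//|TAx]; split.
apply: (dimq_iso (f := T)) => //; first exact: bT.1.
- exact: subsp_image.
- by move=> _ [x Ax <-]; exists x => //; rewrite subrr; exact: (subsp_image bT sTA).1.
move=> x Ax; split.
  move=> [u [v [TAu [Tv _] ->]]]; exists u => //.
  by rewrite (bopD bT) Tv addr0.
move=> [u TAu Tu]; exists u, (x - u); rewrite subrKC; split=> //; split.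
  by rewrite /opker /= (bopB bT) Tu subrr.
by apply: subspB => //; exact: TA.
Qed.

Lemma range_iterS n : range (iter n.+1 T) = T @` range (iter n T).
Proof. by rewrite image_comp. Qed.

Lemma range_iter_dec n m : (n <= m)%N -> range (iter m T) `<=` range (iter n T).
Proof.
move=> /subnKC <- _ [x _ <-]; exists (iter (m - n) T x) => //.
by rewrite -iterD.
Qed.

Lemma subsp_range_iter n : subsp (range (iter n T)).
Proof. by apply: subsp_image; [exact: bop_iter|exact: subspT]. Qed.

Lemma iter_step n :
  dimq (opker T `&` range (iter n T)) [set 0] =
    (jump (range (iter n T)) + dimq (opker T `&` range (iter n.+1 T)) [set 0%R])%E /\
  dimq (range (iter n T)) (range (iter n.+1 T)) =
    (jump (range (iter n T)) + dimq (range (iter n.+1 T)) (range (iter n.+2 T)))%E.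
Proof.
rewrite !range_iterS; apply: one_step; first exact: subsp_range_iter.
by rewrite -range_iterS; exact: range_iter_dec.
Qed.

(** [d] is the sum of the first [n] jumps and may be infinite. *)
Lemma iter_steps n : exists2 d : \bar R, (0 <= d)%E &
  dimq (opker T) [set 0%R] = (d + dimq (opker T `&` range (iter n T)) [set 0%R])%E /\
  dimq setT (range T) = (d + dimq (range (iter n T)) (range (iter n.+1 T)))%E.
Proof.
elim: n => [|n [d d0 [h1 h2]]].
  exists 0%E => //; rewrite !add0e.
  have -> : range (iter 0 T) = setT by rewrite image_id.
  by rewrite setIT range_iterS image_id.
have [k1 k2] := iter_step n.
exists (d + jump (range (iter n T)))%E; first by rewrite adde_ge0 // dimq_ge0.
by rewrite h1 h2 k1 k2 !addeA.
Qed.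

(** Strong induction on a finite value of [a]: a non-zero [d m] makes [a m.+1] strictly smaller, and
    the argument restarts there. *)
Lemma stabilize (a : nat -> \bar R) (d : nat -> \bar R) :
  (forall n, (0 <= d n)%E) ->
  (forall n, (exists k : nat, a n = k%:R%:E) \/ a n = +oo%E) ->
  (forall n, a n = (d n + a n.+1)%E) -> (a 0%N < +oo)%E ->
  exists N, forall n, (N <= n)%N -> d n = 0%E.
Proof.
move=> d0 nat_a step; move: {1}0%N => n0.
have dec n m : (n <= m)%N -> (a m <= a n)%E.
  move=> /subnKC <-; elim: (m - n)%N => [|k IH]; first by rewrite addn0.
  by rewrite addnS; apply: le_trans IH; rewrite [leRHS]step leeDr.
case: (nat_a n0) => [[k hk] _|-> //].
elim/ltn_ind: k n0 hk => k IH n0 hk.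
have [h|/existsNP[m /not_implyP[nm dm]]] := pselect (forall m, (n0 <= m)%N -> d m = 0%E).
  by exists n0.
have am := dec _ _ nm; have := step m.
have [[k' hk']|h'] := nat_a m.+1; last first.
  by move: am; rewrite hk (step m) h' addey ?leye_eq // gt_eqF // (lt_le_trans _ (d0 m)) // ltNyr.
move=> sm; apply: (IH k' _ m.+1 hk').
rewrite hk sm hk' in am.
have {dm} : (0 < d m)%E by rewrite lt_neqAle d0 eq_sym andbT; apply/eqP.
case: (d m) am => [r| |]; rewrite ?lee_fin ?lte_fin //.
by move=> h r0; rewrite -(ltr_nat R); lra.
Qed.

Lemma jump_eventually0 :
  (dimq (opker T) [set 0%R] < +oo)%E \/ (dimq setT (range T) < +oo)%E ->
  exists N, forall n, (N <= n)%N -> jump (range (iter n T)) = 0%E.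
Proof.
have e0 : range (iter 0 T) = setT by rewrite image_id.
case=> h.
  apply: (@stabilize (fun n => dimq (opker T `&` range (iter n T)) [set 0])).
  - by move=> n; exact: dimq_ge0.
  - by move=> n; exact: dimq_dich.
  - by move=> n; have [] := iter_step n.
  by rewrite e0 setIT.
apply: (@stabilize (fun n => dimq (range (iter n T)) (range (iter n.+1 T)))).
- by move=> n; exact: dimq_ge0.
- by move=> n; exact: dimq_dich.
- by move=> n; have [] := iter_step n.
by rewrite range_iterS e0.
Qed.

Lemma fin_basis (A B : set X) : subsp B -> (dimq A B < +oo)%E ->
  exists n (e : 'I_n -> X), [/\ forall j, A (e j), indep_fam B e & A `<=` addspan B e].
Proof.
move=> sB fin; have [[n hn]|h] := dimq_dich A B; last by rewrite h in fin.
have [|e [Ae ie]] := @dimq_geP _ _ A B n; first by rewrite hn.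
exists n, e; split=> // x; apply: (indep_span sB Ae ie) => /dimq_ge.
by rewrite hn lee_fin ler_nat ltnn.
Qed.

End Chain.

(** A finite basis modulo the range spans a closed algebraic complement, so [compl_closed_range]
    applies. *)
Lemma fin_codim_closed (X : completeNormedModType R[i]) (T : X -> X) :
  bop T -> (dimq setT (range T) < +oo)%E -> closed (range T).
Proof.
move=> bT fin; have sR := subsp_image bT (subspT _).
have [n [e [_ ie sp]]] := fin_basis sR fin.
have c0 : closed [set (0 : X)].
  by apply/closed_rnP => x h; apply/rn_small0 => r /h[_ ->]; rewrite subr0 => /ltW.
have [sF cF] := addspan_subsp_closed e (@subsp0 _ X) c0.
apply: (@compl_closed_range _ _ _ (mkcsub sF cF)) => //= [y|x [a]].
  have [a [x _ hx]] := sp y I; exists x, (\sum_(j < n) a j *: e j).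
  by rewrite hx subrK; split=> //; exists a; rewrite subrr.
move=> /eqP; rewrite subr_eq0 => /eqP h.
have a0 : forall j, a j = 0 by apply: ie; rewrite -h; exists x.
by rewrite h big1 // => j _; rewrite a0 scale0r.
Qed.

Section Reduction.
Variable X : completeNormedModType R[i].
Variable T : X -> X.
Hypothesis bT : bop T.

(** With finite nullity, adding a kernel basis to [range (iter n T)] keeps it closed and does not
    change its image, and the sum contains the kernel. With finite deficiency, all powers have
    finite codimension. *)
Lemma semiFredholm_closed_iter n :
  closed (range T) ->
  (dimq (opker T) [set 0%R] < +oo)%E \/ (dimq setT (range T) < +oo)%E ->
  closed (range (iter n T)).
Proof.
move=> cT [fin|fin].
  have [k [e [Ke _ sp]]] := fin_basis (@subsp0 _ X) fin.
  have [C C0 hC] := closed_range_liftable bT cT.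
  elim: n => [|n IH]; first by rewrite image_id; exact: closedT.
  have sR := subsp_range_iter bT n.
  have [sZ cZ] := addspan_subsp_closed e sR IH.
  rewrite range_iterS (_ : _ @` _ = T @` addspan (range (iter n T)) e).
    apply: (liftable_closed_image bT C0 hC cT sZ cZ) => x /sp[a /eqP]; rewrite subr_eq0 => /eqP ->.
    by exists a; rewrite subrr; exact: sR.1.
  apply/seteqP; split=> [_ [x Rx <-]|_ [x [a Rx] <-]].
    by exists x => //; exists (fun=> 0); rewrite big1 ?subr0 // => j _; rewrite scale0r.
  exists (x - \sum_(j < k) a j *: e j) => //.
  rewrite (bopB bT) (bop_sum bT) big1 ?subr0 // => j _.
  by rewrite (bopZ bT) Ke scaler0.
apply: fin_codim_closed; first exact: bop_iter.
have codim_fin m : (dimq (range (iter m T)) (range (iter m.+1 T)) < +oo)%E.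
  have [d d0 [_ h]] := iter_steps bT m; rewrite h in fin.
  by apply: le_lt_trans fin; rewrite leeDr.
elim: n => [|n IH]; first by rewrite image_id dimq_sub0 ?ltry.
rewrite (@dimq_add _ _ _ (range (iter n T))) ?lte_add_pinfty //.
- exact: subsp_range_iter.
- exact: subsp_range_iter.
- exact: range_iter_dec.
Qed.

(** Once the jumps vanish, a kernel vector in [range (iter d T)] climbs through the ranges of all
    higher powers. *)
Lemma kato_reduction :
  closed (range T) ->
  (dimq (opker T) [set 0%R] < +oo)%E \/ (dimq setT (range T) < +oo)%E ->
  exists d (Y : closed_subspace X) (TY : invariant_sub T Y),
    csub_set Y = range (iter d T) /\ Kato (restr TY).
Proof.
move=> cT fin; have [d hd] := jump_eventually0 bT fin.
pose Y := mkcsub (subsp_range_iter bT d) (@semiFredholm_closed_iter d cT fin).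
have TY : invariant_sub T Y.
  by move=> _ [x _ <-]; exists (T x) => //; rewrite -iterSr.
exists d, Y, TY; split=> //.
have im n : @csub_val _ _ Y @` range (iter n (restr TY)) = range (iter (n + d) T).
  rewrite csub_val_image; apply/seteqP; split=> x.
    by move=> [_ [y _ <-] <-]; exists y => //; rewrite iterD.
  by move=> [y _ <-]; exists (iter d T y); [exists y|rewrite iterD].
have mem n u : range (iter (n + d) T) (csub_val u) -> range (iter n (restr TY)) u.
  by rewrite -im => -[v Rv /csub_val_inj <-].
split.
  rewrite (_ : range _ = @csub_val _ _ Y @^-1` range (iter (1 + d) T)).
    by apply: closed_csub_preimage; exact: semiFredholm_closed_iter.
  apply/seteqP; split=> u; last exact: (mem 1%N).
  by move=> Ru; change (range (iter (1 + d) T) (csub_val u)); rewrite -im; exists u.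
move=> n u /(congr1 (@csub_val _ _ _)) /= Tu; apply: mem.
elim: n => [|n IH]; first exact: (csub_valP u).
have sK := subspI (subsp_ker bT) (subsp_range_iter bT (n + d).+1).
have := hd (n + d)%N (leq_addl _ _); rewrite /jump -range_iterS => /(dimq0_sub sK) h.
by have [] := h (csub_val u) (conj Tu IH).
Qed.

Variables (d : nat) (Y : closed_subspace X) (TY : invariant_sub T Y).
Hypothesis Yd : csub_set Y = range (iter d T).
Variable mu : R[i].
Hypothesis mu0 : mu != 0.
Let S := opshift T mu.
Let bS : bop S. Proof. exact: bop_opshift. Qed.

(** Since [mu *: x = T x - S x] and [mu != 0], membership of [x] in the range of a power improves by
    one exponent until [d] is reached. *)
Lemma shift_memY x : csub_set Y (S x) -> csub_set Y x.
Proof.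
rewrite Yd => Sx; have {Sx}h n : (n <= d)%N -> range (iter n T) x.
  elim: n => [|n IH] nd; first by exists x.
  rewrite -[x]scale1r -(mulVf mu0) -scalerA; apply: subspZ; first exact: subsp_range_iter.
  have -> : mu *: x = T x - S x by rewrite /S opshiftE subKr.
  apply: subspB; first exact: subsp_range_iter.
    by have [y _ <-] := IH (ltnW nd); exists y.
  exact: range_iter_dec Sx.
exact: h.
Qed.

(* S divides T^n - mu^n. *)
Lemma iter_shift_range n x : range S (iter n T x - mu ^+ n *: x).
Proof.
have sR := subsp_image bS (subspT _).
elim: n => [|n IH]; first by rewrite expr0 scale1r subrr; exact: sR.1.
rewrite (_ : _ - _ = S (iter n T x) + mu *: (iter n T x - mu ^+ n *: x)).
  by apply: subspD => //; exact: subspZ.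
by rewrite /S opshiftE scalerBr scalerA -exprS addrA subrK.
Qed.

Lemma shift_closed : closed (S @` csub_set Y) -> closed (range S).
Proof.
move=> cSY; have sR := subsp_image bS (subspT _).
have bd := bop_iter d bT; have [_ [K K0 hK]] := bd.
have Rd x : range S (iter d T x) -> range S x.
  move=> h; have := subspB sR h (iter_shift_range d x); rewrite subKr.
  move=> /(subspZ sR (mu ^+ d)^-1); rewrite scalerA mulVf ?scale1r //.
  by rewrite expf_neq0.
have RY x : range S (iter d T x) -> (S @` csub_set Y) (iter d T x).
  by move=> [y _ hy]; exists y => //; apply: shift_memY; rewrite hy Yd; exists x.
apply/closed_rnP => x hx; apply: Rd.
suff : (S @` csub_set Y) (iter d T x) by move=> [y _ <-]; exists y.
have /closed_rnP := cSY; apply => e e0.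
have [|_ [y _ <-] h] := hx (e / K); first by rewrite divr_gt0.
exists (iter d T (S y)).
  apply: RY; exists (iter d T y) => //.
  by rewrite /S !opshiftE (bopB bd) (bopZ bd) -iterSr.
rewrite -(bopB bd); apply: le_lt_trans (hK _) _.
by rewrite mulrC -ltr_pdivlMr.
Qed.

(** The kernel lies in [Y] by [shift_memY], and every [x] is congruent modulo [range S] to a
    multiple of [iter d T x], which lies in [Y]. *)
Lemma shift_dims :
  dimq (opker S) [set 0] = dimq (opker S `&` csub_set Y) [set 0] /\
  dimq setT (range S) = dimq (csub_set Y) (S @` csub_set Y).
Proof.
split.
  congr dimq; apply/seteqP; split=> x; last by case.
  move=> Sx; split=> //; apply: shift_memY; rewrite Sx; exact: (csub_subsp Y).1.
symmetry; have sR := subsp_image bS (subspT _); apply: dimq_id => //; first exact: csub_subsp.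
  move=> x _; exists ((mu ^+ d)^-1 *: iter d T x).
    by apply: (subspZ (csub_subsp Y)); rewrite Yd; exists x.
  have := subspZ sR (mu ^+ d)^-1 (iter_shift_range d x).
  by rewrite scalerBr scalerA mulVf ?scale1r // expf_neq0.
move=> x Yx; split=> [[y _ <-]|[y _ hy]]; first by exists y.
by exists y => //; apply: shift_memY; rewrite hy.
Qed.

End Reduction.

End SemiFredholm.

(** * The classes R_i in terms of nullity and deficiency *)

Section Classes.
Variable R : realType.

Lemma ldimE (X : completeNormedModType R[i]) (A : set X) : ldim A = dimq A [set 0].
Proof. by []. Qed.

Lemma lcodimE (X : completeNormedModType R[i]) (A : set X) : lcodim A = dimq setT A.
Proof.
rewrite /lcodim /dimq; congr ereal_sup; congr image; apply/seteqP; split=> n [e].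
  by move=> ie; exists e.
by move=> [_ ie]; exists e.
Qed.

(** [a] and [b] are the nullity and deficiency of the Kato restriction to [range (iter d T)]. Only
    for [mu != 0] does the shift on the whole space share them. *)
Lemma kato_near (X : completeNormedModType R[i]) (T : X -> X) :
  bop T -> closed (range T) ->
  (dimq (opker T) [set 0%R] < +oo)%E \/ (dimq setT (range T) < +oo)%E ->
  exists d a b : \bar R, [/\ (0 <= d)%E, (0 <= a)%E, (0 <= b)%E,
    dimq (opker T) [set 0%R] = (d + a)%E /\ dimq setT (range T) = (d + b)%E &
    exists2 eps : R, 0 < eps & forall mu, mu != 0 -> rn mu < eps ->
     [/\ Kato (opshift T mu), dimq (opker (opshift T mu)) [set 0%R] = a &
        dimq setT (range (opshift T mu)) = b]].
Proof.
move=> bT cT fin; have [d [Y [TY [Yd kY]]]] := kato_reduction bT cT fin.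
have bY := bop_restr TY bT.
have [del del0 [ha hb]] := iter_steps bT d.
exists del, (dimq (opker (restr TY)) [set 0]), (dimq setT (range (restr TY))).
split; rewrite ?dimq_ge0 //.
  by rewrite dim_ker_restr // codim_restr // Yd ha hb range_iterS.
have [eps eps0 he] := kato_dims bY kY; exists eps => // mu mu0 hmu.
have [] := he _ hmu; have SY := invariant_opshift mu TY.
rewrite (restr_opshift TY SY) => kS <- <-; have bS := bop_opshift mu bT.
have [-> ->] := shift_dims bT Yd mu0.
rewrite dim_ker_restr // codim_restr //; split=> //; split.
  by apply: (shift_closed bT Yd mu0); rewrite -(range_restr SY); exact/closed_csub_image/kS.1.
move=> n x Sx; have /csub_ex[u ux] : csub_set Y x.
  by apply: (shift_memY bT Yd mu0); rewrite Sx; exact: (csub_subsp Y).1.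
have [|v _ hv] := kS.2 n u; first by apply: csub_val_inj; rewrite /= ux.
by exists (csub_val v) => //; rewrite -val_iter_restr hv.
Qed.

(* The condition on nullity a and deficiency b that, with a closed range,
   characterizes the class R_i. *)
Definition dclass (i : nat) (a b : \bar R) : Prop :=
  match i with
  | 1 => a = 0%E
  | 2 => b = 0%E
  | 3 => a = 0%E /\ b = 0%E
  | 4 => (a < +oo)%E
  | 5 => (b < +oo)%E
  | 6 => (a < +oo)%E /\ (b < +oo)%E
  | 7 => (a < +oo)%E /\ (a - b <= 0)%E
  | 8 => (b < +oo)%E /\ (0 <= a - b)%E
  | 9 => ((a < +oo)%E /\ (b < +oo)%E) /\ (a - b)%E = 0%E
  | _ => False
  end.

(** Every condition makes one of the sums finite, so [d] is finite and cancels, even when the other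
    sum is infinite. *)
Lemma dclass_sub i (d a b : \bar R) : (0 <= d)%E -> (0 <= a)%E -> (0 <= b)%E ->
  dclass i (d + a) (d + b) -> dclass i a b.
Proof.
have lty (x y : \bar R) : (0 <= x)%E -> (0 <= y)%E -> (x + y < +oo)%E -> (x < +oo)%E /\ (y < +oo)%E.
  by move=> x0 y0 h; split; apply: le_lt_trans h; rewrite ?leeDl ?leeDr.
have eq0 (x y : \bar R) : (0 <= x)%E -> (0 <= y)%E -> (x + y = 0)%E -> y = 0%E.
  by move=> x0 y0 /eqP; rewrite padde_eq0 // => /andP[_ /eqP].
move=> d0 a0 b0; do 10?[case: i => [|i]] => //=.
- exact: eq0.
- exact: eq0.
- by move=> [/eq0 -> // /eq0 ->].
- by move=> /lty[].
- by move=> /lty[].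
- by move=> [/lty[] // _ -> /lty[]].
- move=> [/lty[//|//|dy ay]]; move: d a b d0 a0 b0 dy ay => [d| |] [a| |] [b| |] //= _ _ _ _ _.
  by rewrite !lee_fin => h; split; [exact: ltry|lra].
- move=> [/lty[//|//|dy ay]]; move: d a b d0 a0 b0 dy ay => [d| |] [a| |] [b| |] //= _ _ _ _ _.
  by rewrite !lee_fin => h; split; [exact: ltry|lra].
move=> [[/lty[//|//|dy ay] /lty[//|//|_ by']]].
move: d a b d0 a0 b0 dy ay by' => [d| |] [a| |] [b| |] //= _ _ _ _ _ _ [h].
by split; [split; exact: ltry|congr EFin; lra].
Qed.

Lemma dclass_fin i (a b : \bar R) : dclass i a b -> (a < +oo)%E \/ (b < +oo)%E.
Proof.
do 10?[case: i => [|i]] => //=.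
- by move=> ->; left; rewrite ltry.
- by move=> ->; right; rewrite ltry.
- by move=> [-> _]; left; rewrite ltry.
- by left.
- by right.
- by case=> ? _; left.
- by case=> ? _; left.
- by case=> ? _; right.
- by case=> [[? _] _]; left.
Qed.

Lemma injective_ker0 (X : completeNormedModType R[i]) (T : X -> X) :
  (forall x, T x = 0 -> x = 0) -> dimq (opker T) [set 0] = 0%E.
Proof. by move=> h; apply: dimq_sub0 => //; exact: subsp0. Qed.

Lemma bounded_belowP (X : completeNormedModType R[i]) (T : X -> X) : bop T ->
  bounded_below T <-> closed (range T) /\ dimq (opker T) [set 0] = 0%E.
Proof.
move=> bT; split=> [[c c0 hc]|[cT k0]].
  have [cE c1] := posC c0; set k := complex.Re c in cE c1.
  have {}hc x : k * rn x <= rn (T x).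
    by have := hc x; rewrite cE !rnE -rmorphM lecR.
  split.
    apply: (@liftable_closed _ _ _ _ k^-1) => //; first by rewrite invr_ge0 ltW.
    by move=> x; exists x => //; rewrite ler_pdivlMl.
  apply: injective_ker0 => x Tx; apply: rn_eq0; apply/eqP.
  rewrite eq_le rn_ge0 andbT; have := hc x; rewrite Tx rn0 pmulr_rle0 //.
have [C C0 hC] := closed_range_liftable bT cT.
exists (C^-1)%:C; first by rewrite ltcR invr_gt0.
move=> x; rewrite !rnE -rmorphM lecR ler_pdivrMl //.
have [x' hx' hx] := hC x.
have : (opker T) (x' - x) by rewrite /opker /= (bopB bT) hx' subrr.
by move=> /(dimq0_sub (@subsp0 _ X) k0) /eqP; rewrite subr_eq0 => /eqP xx; rewrite -{1}xx.
Qed.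

Lemma surjective_opP (X : completeNormedModType R[i]) (T : X -> X) : bop T ->
  surjective_op T <-> closed (range T) /\ dimq setT (range T) = 0%E.
Proof.
move=> bT; have sR := subsp_image bT (@subspT _ X).
split=> [h|[_ h]]; first by rewrite h; split; [exact: closedT|exact: dimq_sub0].
by apply/seteqP; split=> //; exact: dimq0_sub h.
Qed.

Lemma invertible_opP (X : completeNormedModType R[i]) (T : X -> X) : bop T ->
  invertible_op T <->
  [/\ closed (range T), dimq (opker T) [set 0] = 0%E & dimq setT (range T) = 0%E].
Proof.
move=> bT; split.
  move=> [S [cS TS ST]].
  have : surjective_op T by apply/seteqP; split=> // y _; exists (S y).
  move=> /(surjective_opP bT)[? ?]; split=> //; apply: injective_ker0 => x Tx.
  by rewrite -[x]TS Tx linear0.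
move=> [cT k0 r0]; have /(surjective_opP bT) surj := conj cT r0.
have [C C0 hC] := closed_range_liftable bT cT.
have inj x y : T x = T y -> x = y.
  move=> h; apply/eqP; rewrite -subr_eq0; apply/eqP.
  by apply: (dimq0_sub (@subsp0 _ X) k0); rewrite /opker /= (bopB bT) h subrr.
have /choice[g gT] : forall y, exists x, T x = y.
  by move=> y; have : range T y by [rewrite surj]; case=> x _ hx; exists x.
have lg : linear g by move=> a x y; apply: inj; rewrite bT.1 !gT.
pose S : {linear X -> X} := HB.pack g (GRing.isLinear.Build _ _ _ _ g lg).
have TS : cancel T S by move=> x; apply: inj; rewrite /= gT.
exists S; split=> //; apply: bop_continuous; split; first exact: lg.
exists C => // y; have [x hx hxC] := hC (g y).
by rewrite -[S y]/(g y) -(inj _ _ hx); move: hxC; rewrite gT.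
Qed.

Lemma classRP (X : completeNormedModType R[i]) (T : X -> X) (i : nat) :
  bop T -> classR i T <->
  closed (range T) /\ dclass i (dimq (opker T) [set 0]) (dimq setT (range T)).
Proof.
move=> bT; have fcc := fin_codim_closed bT.
do 10?[case: i => [|i]] => /=;
  rewrite /Weyl /lower_semiWeyl /upper_semiWeyl /Fredholm /lower_semiFredholm
    /upper_semiFredholm /fredholm_index ?ldimE ?lcodimE.
- by split=> // -[].
- exact: bounded_belowP.
- exact: surjective_opP.
- by rewrite invertible_opP //; split=> [[]|[? []]].
- by split=> [[]|[]].
- by split=> [h|[]//]; split=> //; exact: fcc.
- by split=> [[[]]|[? []]].
- by split=> [[[? ?] ?]|[? [? ?]]].
- by split=> [[? ?]|[? [? ?]]] //; split=> //; exact: fcc.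
- by split=> [[[[? ?] ?] ?]|[? [[? ?] ?]]].
by split=> // -[].
Qed.

Lemma classR_near (X : completeNormedModType R[i]) (T : X -> X) (i : nat) :
  bop T -> classR i T -> exists2 eps : R, 0 < eps &
  forall mu, mu != 0 -> rn mu < eps -> Kato (opshift T mu) /\ classR i (opshift T mu).
Proof.
move=> bT /(classRP _ bT)[cT hc].
have [d [a [b [d0 a0 b0 [ha hb] [eps eps0 h]]]]] := kato_near bT cT (dclass_fin hc).
exists eps => // mu mu0 /(h _ mu0)[kS hSa hSb]; split=> //.
apply/(classRP _ (bop_opshift mu bT)); split; first exact: kS.1.
by rewrite hSa hSb; apply: (dclass_sub d0) => //; rewrite -ha -hb.
Qed.

End Classes.

(** * Poles of the resolvent *)

Section Poles.
Variable R : realType.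

Lemma geometric_tail (q : R) n : 0 <= q -> q <= 2^-1 -> \sum_(j < n) q ^+ j.+1 <= 2 * q.
Proof.
move=> q0 q1; suff : \sum_(j < n) q ^+ j.+1 <= 2 * q - 2 * q ^+ n.+1.
  by move/le_trans; apply; rewrite gerBl mulr_ge0 // exprn_ge0.
elim: n => [|n IH]; first by rewrite big_ord0 expr1 subrr.
rewrite big_ord_recr /= [q ^+ n.+2]exprS.
have : 0 <= q ^+ n.+1 by exact: exprn_ge0.
set t := q ^+ n.+1 in IH *; move=> t0.
have : q * t <= 2^-1 * t by rewrite ler_wpM2r.
lra.
Qed.

Section PowerSeries.
Variable V : normedModType R[i].

(** Pointwise convergence suffices, and [z = 0] is left out because the Laurent expansion holds only
    off the pole. *)
Definition null_series (r : R) (c : nat -> V) : Prop :=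
  forall z : R[i], 0 < rn z -> rn z < r -> forall e : R, 0 < e -> exists N, forall n, (N <= n)%N ->
    rn (\sum_(k < n) z ^+ k *: c k) < e.

(** Convergence at one point of norm [r / 2] bounds the terms there by some [M]. At a point [q]
    times smaller the terms after the first sum to at most [2 * M * q], which is arbitrarily
    small. *)
Lemma null_series_head r c : 0 < r -> null_series r c -> c 0%N = 0.
Proof.
move=> r0 hc; pose z0 : R[i] := (r / 2)%:C.
have rz0 : rn z0 = r / 2 by rewrite rn_real gtr0_norm // divr_gt0.
have [|||N hN] := hc z0 _ _ 1; rewrite ?rz0; [lra|lra|lra|].
(* Beyond [N], a term is the difference of two partial sums of norm below 1; the sum covers the
   earlier terms. *)
pose M : R := 2 + \sum_(j < N) rn (c j) * (r / 2) ^+ j.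
have hM n : rn (c n) * (r / 2) ^+ n <= M.
  have s0 : 0 <= \sum_(j < N) rn (c j) * (r / 2) ^+ j.
    by apply: sumr_ge0 => j _; rewrite mulr_ge0 ?rn_ge0 // exprn_ge0 //; lra.
  have [nN|Nn] := ltnP n N.
    rewrite /M (bigD1 (Ordinal nN)) //= addrCA lerDl addr_ge0 //.
    by apply: sumr_ge0 => j _; rewrite mulr_ge0 ?rn_ge0 // exprn_ge0 //; lra.
  have h1 := hN _ Nn; have h2 := hN _ (leq_trans Nn (leqnSn n)).
  rewrite big_ord_recr /= in h2.
  have : rn (z0 ^+ n *: c n) <= 2.
    rewrite -[_ *: _](addKr (\sum_(k < n) z0 ^+ k *: c k)) addrC.
    apply: le_trans (rnB _ _) _; lra.
  by rewrite rnZ rnX rz0 /M mulrC => h; lra.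
have M0 : 0 <= M by apply: le_trans (hM 0%N); rewrite mulr_ge0 ?rn_ge0 // exprn_ge0 //; lra.
apply: rn_small0 => e e0.
pose q : R := Num.min 2^-1 (e / (4 * (M + 1))).
have q0 : 0 < q by rewrite lt_min invr_gt0 ltr0n /= divr_gt0 // mulr_gt0 //; lra.
have q1 : q <= 2^-1 by rewrite ge_min lexx.
have qe : 2 * M * q <= e / 2.
  have : q * (4 * (M + 1)) <= e.
    by rewrite -ler_pdivlMr ?ge_min ?lexx ?orbT // mulr_gt0 //; lra.
  by have := mulr_ge0 M0 (ltW q0); lra.
pose z : R[i] := (q * (r / 2))%:C.
have rz : rn z = q * (r / 2) by rewrite rn_real gtr0_norm // mulr_gt0 // divr_gt0.
have qr : q * (r / 2) <= 2^-1 * (r / 2) by rewrite ler_wpM2r //; lra.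
have qr0 : 0 < q * (r / 2) by rewrite mulr_gt0 // divr_gt0.
have [|||n hn] := hc z _ _ (e / 2); rewrite ?rz; [lra|lra|lra|].
have := hn n.+1 (leqnSn n); rewrite big_ord_recl expr0 scale1r.
set s := \sum_(i < n) _ => hs.
have : rn s <= \sum_(j < n) M * q ^+ j.+1.
  apply: le_trans (rn_sum _) _; apply: ler_sum => j _.
  rewrite rnZ rnX rz /= exprMn -mulrA [M * _]mulrC ler_wpM2l ?exprn_ge0 ?(ltW q0) //.
  by rewrite mulrC; exact: hM.
rewrite -mulr_sumr => h.
have h' : M * (\sum_(j < n) q ^+ j.+1) <= M * (2 * q).
  by rewrite ler_wpM2l // geometric_tail // ltW.
rewrite -[c 0%N](addrK s); apply: le_trans (rnB _ _) _; lra.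
Qed.

(** Since the constant coefficient vanishes, the series can be divided by the non-zero [z]. *)
Lemma null_series_shift r c : 0 < r -> null_series r c -> null_series r (fun k => c k.+1).
Proof.
move=> r0 hc z z0 zr e e0.
have [N hN] := hc z z0 zr _ (mulr_gt0 z0 e0).
exists N => n Nn; rewrite -(ltr_pM2l z0) -rnZ.
have := hN n.+1 (leq_trans Nn (leqnSn n)).
rewrite big_ord_recl (null_series_head r0 hc) scaler0 add0r scaler_sumr.
by under eq_bigr do rewrite exprS -scalerA.
Qed.

Lemma null_series_coef r c k : 0 < r -> null_series r c -> c k = 0.
Proof.
move=> r0; elim: k c => [|k IH] c hc; first exact: null_series_head hc.
exact: (IH (fun k => c k.+1) (null_series_shift r0 hc)).
Qed.

End PowerSeries.

Section Drazin.
Variable Y : completeNormedModType R[i].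

(* With p = 0 this says that A is invertible. *)
Definition drazin (A : Y -> Y) (p : nat) : Prop :=
  exists D : Y -> Y, [/\ bop D, forall x, D (A x) = A (D x) &
    forall x, iter p.+1 A (D x) = iter p A x].

Lemma drazin_invertible (A : Y -> Y) : invertible_op A -> drazin A 0.
Proof.
move=> [S [cS AS SA]]; exists S; split=> [|x|x]; first exact: continuous_bop.
  by rewrite AS SA.
by rewrite /= SA.
Qed.

(* If p is the order of the pole and D_k are the Laurent coefficients, comparing
   coefficients in (A - z) S = S (A - z) = 1 gives A D_k = D_k A = D_(k-1) for
   k <> p and A D_p = D_p A = D_(p-1) + 1, whence D_p is the required operator. *)
Lemma drazin_pole (T : Y -> Y) (l : R[i]) :
  bop T -> resolvent_pole T l -> exists p, drazin (opshift T l) p.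
Proof.
move=> bT [_ [p [D [r [p0 r0 cD _ hD]]]]]; exists p, (D p).
have [rE r1] := posC r0; set r' := complex.Re r in rE r1.
pose A := opshift T l; have bA : bop A := bop_opshift l bT.
have bD k : bop (D k) := continuous_bop (cD k).
have regroup (s1 s2 a b : Y) : s1 - (s2 + (a - b)) = s1 - a - (s2 - b).
  by rewrite addrCA opprD addrA.
(* With the convention D_(-1) = 0, these are the coefficients of [z ^+ k] in [z] times the series of
   the [D k x], and in [z ^+ p *: x]. *)
pose prev k x := if k is k'.+1 then D k' x else 0.
pose unit k (x : Y) := if k == p then x else 0.
(* Multiplying by [z ^+ p] turns the Laurent series into a power series. The tolerance involves
   [rn x + 1] so that [x = 0] needs no separate case. *)
have lim (z : R[i]) : 0 < rn z -> rn z < r' -> exists2 S : {linear Y -> Y},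
    bounded_inverse (opshift A z) S & forall x (e : R), 0 < e -> exists N, forall n, (N <= n)%N ->
      rn (\sum_(k < n) z ^+ k *: D k x - z ^+ p *: S x) < e.
  move=> z0 zr; have z1 : z != 0 by apply/eqP => h; rewrite h rn0 ltxx in z0.
  have [|S hS hcv] := hD (l + z).
    by rewrite addrC addKr rE rnE (_ : 0 = (0 : R)%:C) // !ltcR z0 zr.
  exists S; first by rewrite /A opshiftD.
  move=> x e e0; have zp0 : 0 < rn (z ^+ p) by rewrite rnX exprn_gt0.
  have K0 : 0 < rn (z ^+ p) * (rn x + 1).
    by rewrite mulr_gt0 //; have := rn_ge0 x; lra.
  have [|N _ hN] := hcv (e / (rn (z ^+ p) * (rn x + 1)))%:C.
    by rewrite ltcR divr_gt0.
  exists N => n Nn; have := hN n Nn x; rewrite /= [l + z]addrC addrK !rnE -rmorphM lecR => h.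
  have -> : \sum_(k < n) z ^+ k *: D k x - z ^+ p *: S x =
     z ^+ p *: (\sum_(k < n) z ^ (k%:Z - p%:Z) *: D k x - S x).
    rewrite scalerBr scaler_sumr; congr (_ - _); apply: eq_bigr => k _.
    rewrite scalerA; congr (_ *: _).
    by rewrite !exprnP -expfzDr // addrC subrK.
  rewrite rnZ; apply: (@le_lt_trans _ _ (rn (z ^+ p) * (e / (rn (z ^+ p) * (rn x + 1)) * rn x))).
    by rewrite ler_pM2l.
  have x1 : rn x + 1 != 0 by rewrite gt_eqF //; have := rn_ge0 x; lra.
  have -> : rn (z ^+ p) * (e / (rn (z ^+ p) * (rn x + 1)) * rn x) = e * (rn x / (rn x + 1)).
    by field; rewrite x1 gt_eqF.
  rewrite gtr_pMr // ltr_pdivrMr; last by have := rn_ge0 x; lra.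
  by rewrite mul1r ltrDl.
have psum (z : R[i]) x n : (p < n)%N ->
    \sum_(k < n.+1) z ^+ k *: (prev k x + unit k x) =
    z *: (\sum_(k < n) z ^+ k *: D k x) + z ^+ p *: x.
  move=> pn; under eq_bigr do rewrite scalerDr.
  rewrite big_split /=; congr (_ + _).
    rewrite big_ord_recl /= scaler0 add0r scaler_sumr; apply: eq_bigr => k _.
    by rewrite exprS scalerA.
  have pn1 : (p < n.+1)%N by rewrite ltnS ltnW.
  rewrite (bigD1 (Ordinal pn1)) //= /unit eqxx big1 ?addr0 // => k kp.
  rewrite ifF ?scaler0 //; apply/negbTE; apply: contra kp => /eqP kp.
  exact/eqP/val_inj.
have coefL k x : A (D k x) = prev k x + unit k x.
  apply/eqP; rewrite -subr_eq0; apply/eqP.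
  apply: (@null_series_coef _ r' (fun k => A (D k x) - (prev k x + unit k x))) => //.
  move=> z z0 zr e e0; have [S [_ _ SK] hS] := lim z z0 zr.
  have [_ [K K0 hK]] := bA.
  have d0 : 0 < K + rn z + 1 by have := rn_ge0 z; lra.
  have [N hN] := hS x _ (divr_gt0 e0 d0).
  exists (maxn N p.+1).+1 => -[//|n]; rewrite ltnS geq_max => /andP[Nn pn].
  (* The partial sum of the differences is [A] applied to the remainder with [n.+1] terms, minus [z]
     times the remainder with [n] terms; both tend to 0. *)
  have E : \sum_(k < n.+1) z ^+ k *: (A (D k x) - (prev k x + unit k x)) =
     A (\sum_(k < n.+1) z ^+ k *: D k x - z ^+ p *: S x) -
     z *: (\sum_(k < n) z ^+ k *: D k x - z ^+ p *: S x).
    have hx : z ^+ p *: x = A (z ^+ p *: S x) - z *: (z ^+ p *: S x).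
      by rewrite -{1}(SK x) opshiftE scalerBr (bopZ bA) !scalerA [z * _]mulrC.
    under eq_bigr do rewrite scalerBr.
    rewrite sumrB psum // hx (bopB bA) (bop_sum bA) scalerBr.
    under [in RHS]eq_bigr do rewrite (bopZ bA).
    exact: regroup.
  rewrite E; apply: le_lt_trans (rnB _ _) _; rewrite rnZ.
  have h1 := hN n.+1 (leq_trans Nn (leqnSn n)); have h2 := hN n Nn.
  rewrite ltr_pdivlMr // in h1; rewrite ltr_pdivlMr // in h2.
  have := hK (\sum_(k < n.+1) z ^+ k *: D k x - z ^+ p *: S x).
  set a := rn (_ - _) in h1 *; set b := rn (_ - _) in h2 *.
  have ea : a < e / (K + rn z + 1) by rewrite ltr_pdivlMr.
  have eb : b < e / (K + rn z + 1) by rewrite ltr_pdivlMr.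
  have ee : (K + rn z + 1) * (e / (K + rn z + 1)) = e by rewrite mulrC divfK ?gt_eqF.
  have eta0 : 0 < e / (K + rn z + 1) by rewrite divr_gt0.
  set eta := e / _ in ea eb ee eta0.
  have : K * a <= K * eta by rewrite ler_pM2l // ltW.
  have : rn z * b <= rn z * eta by rewrite ler_pM2l // ltW.
  lra.
have coefR k x : D k (A x) = prev k x + unit k x.
  apply/eqP; rewrite -subr_eq0; apply/eqP.
  apply: (@null_series_coef _ r' (fun k => D k (A x) - (prev k x + unit k x))) => //.
  move=> z z0 zr e e0; have [S [_ SK _] hS] := lim z z0 zr.
  have d0 : 0 < rn z + 2 by have := rn_ge0 z; lra.
  have [N hN] := hS x _ (divr_gt0 e0 d0).
  have [N' hN'] := hS (A x) _ (divr_gt0 e0 d0).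
  exists (maxn (maxn N N') p.+1).+1 => -[//|n]; rewrite ltnS !geq_max => /andP[/andP[Nn Nn'] pn].
  have E : \sum_(k < n.+1) z ^+ k *: (D k (A x) - (prev k x + unit k x)) =
     (\sum_(k < n.+1) z ^+ k *: D k (A x) - z ^+ p *: S (A x)) -
     z *: (\sum_(k < n) z ^+ k *: D k x - z ^+ p *: S x).
    have hx : z ^+ p *: x = z ^+ p *: S (A x) - z *: (z ^+ p *: S x).
      by rewrite -{1}(SK x) opshiftE linearB linearZ scalerBr !scalerA [z * _]mulrC.
    under eq_bigr do rewrite scalerBr.
    by rewrite sumrB psum // hx [z *: (_ - _)]scalerBr; exact: regroup.
  rewrite E; apply: le_lt_trans (rnB _ _) _; rewrite rnZ.
  have h1 := hN' n.+1 (leq_trans Nn' (leqnSn n)); have h2 := hN n Nn.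
  set a := rn (_ - _) in h1 *; set b := rn (_ - _) in h2 *.
  have ee : (rn z + 2) * (e / (rn z + 2)) = e by rewrite mulrC divfK ?gt_eqF.
  have eta0 : 0 < e / (rn z + 2) by rewrite divr_gt0.
  set eta := e / _ in h1 h2 ee eta0.
  have : rn z * b <= rn z * eta by rewrite ler_pM2l // ltW.
  lra.
split=> [//|x|x]; first by rewrite -/A coefL coefR.
rewrite -/A iterSr coefL /unit eqxx.
(* Below index [p], each application of [A] lowers the index of the coefficient by one, down to
   D_(-1) = 0. *)
have nil k y : (k < p)%N -> iter k.+1 A (D k y) = 0.
  elim: k => [|k IH] kp; rewrite iterSr coefL /unit ltn_eqF // addr0 //=.
  exact: IH (ltnW kp).
rewrite (bopD (bop_iter p bA)) -{1 2}(prednK p0) /= -[A _]/(iter _.+1 A _).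
by rewrite nil ?prednK ?add0r.
Qed.

Variables (A : Y -> Y) (p : nat).
Hypotheses (bA : bop A) (dA : drazin A p).

Lemma iter_comm (D : Y -> Y) n m x : (forall x, D (A x) = A (D x)) ->
  iter n D (iter m A x) = iter m A (iter n D x).
Proof.
move=> DA; have D1 y : D (iter m A y) = iter m A (D y).
  by elim: m => //= k IH; rewrite DA IH.
by elim: n => //= k ->.
Qed.

(** The bounded operator [A^p D^p] fixes every element of [range (iter p A)] and takes its values
    there, so this range is closed. *)
Lemma drazin_closed : closed (range (iter p A)).
Proof.
have [D [bD DA hD]] := dA.
have up k x : iter p A x = iter (k + p) A (iter k D x).
  elim: k x => [//|k IH] x; rewrite addSn -addnS iterD iterS [in RHS]iterS.
  rewrite -[A (iter p A _)]/(iter p.+1 A _) hD -iterD.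
  exact: IH.
have bG : bop (fun y => iter p A (iter p D y)).
  exact: (bop_comp (bop_iter p bD) (bop_iter p bA)).
have fix_ x : iter p A (iter p D (iter p A x)) = iter p A x.
  by rewrite iter_comm // -iterD -up.
have [_ [K K0 hK]] := bG.
apply/closed_rnP => y hy; exists (iter p D y) => //.
apply/eqP; rewrite -subr_eq0; apply/eqP/rn_small0 => e e0.
have [|_ [x _ <-] h] := hy (e / (K + 1)); first by rewrite divr_gt0 //; lra.
rewrite ltr_pdivlMr in h; last by lra.
apply: le_trans (rn_dist (iter p A x) _ _) _.
have := hK (y - iter p A x); rewrite (bopB bG) fix_ (rnBC (iter p A x)).
lra.
Qed.

(** On [range (iter p A)], [D] is a left inverse of [A]. *)
Lemma drazin_ker x : range (iter p A) x -> A x = 0 -> x = 0.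
Proof.
have [D [bD DA hD]] := dA; move=> [y _ <-] Ay.
by rewrite -hD -(@iter_comm D 1 p.+1) //= Ay (bop0 bD).
Qed.

Lemma drazin_range : A @` range (iter p A) = range (iter p A).
Proof.
have [D [bD DA hD]] := dA; apply/seteqP; split=> x.
  by move=> [_ [y _ <-] <-]; exists (A y) => //; rewrite -iterSr.
by move=> [y _ <-]; exists (iter p A (D y)) => //; exact: hD.
Qed.

(** [A] is bijective on [range (iter p A)], so both terms that remain after [iter_steps] vanish and
    only the common summand is left. *)
Lemma drazin_dims : exists2 d : \bar R, (0 <= d)%E &
  dimq (opker A) [set 0%R] = d /\ dimq setT (range A) = d.
Proof.
have [d d0 [h1 h2]] := iter_steps bA p; exists d => //.
have sR := subsp_range_iter bA p.
rewrite h1 h2 range_iterS drazin_range !dimq_sub0 ?adde0 //; first exact: subsp0.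
by move=> x [Ax Rx]; exact: drazin_ker.
Qed.

End Drazin.
End Poles.

(** * Direct sums *)

Section Decomposition.
Variables (R : realType) (X : completeNormedModType R[i]).

(** Take the whole space and the zero space: every operator on the latter is invertible, so its
    spectrum is empty. *)
Lemma kato_gKM (T : X -> X) : bop T -> Kato T -> gKM_decomposable T.
Proof.
move=> bT [cT kT].
have c0 : closed [set (0 : X)].
  by apply/closed_rnP => x h; apply/rn_small0 => r /h[_ ->]; rewrite subr0 => /ltW.
pose M := mkcsub (@subspT R X) closedT; pose N := mkcsub (@subsp0 R X) c0.
have TM : invariant_sub T M by [].
have TN : invariant_sub T N by move=> x ->; exact: (bop0 bT).
exists M, N, TM, TN; split.
- split; first by move=> x; exists x, 0; rewrite addr0.
  by apply/seteqP; split=> x // [].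
- have mem n u : range (iter n T) (csub_val u) -> range (iter n (restr TM)) u.
    move=> [x _ hx]; have [v vx] : exists v : csub_type M, csub_val v = x by exact: csub_ex.
    by exists v => //; apply: csub_val_inj; rewrite val_iter_restr vx.
  split.
    rewrite (_ : range _ = @csub_val _ _ M @^-1` range T); first exact: closed_csub_preimage.
    apply/seteqP; split=> u; last exact: (mem 1%N).
    by move=> [v _ <-]; exists (csub_val v).
  move=> n u /(congr1 (@csub_val _ _ _)) /= Tu.
  exact/mem/kT.
move=> l nl; case: nl; exists idfun.
have all0 (u v : csub_type N) : u = v.
  by apply: csub_val_inj; have -> := csub_valP u; have -> := csub_valP v.
by split=> x; [exact: cvg_id|exact: all0|exact: all0].
Qed.

Variables (B : X -> X) (M N : closed_subspace X).
Variables (BM : invariant_sub B M) (BN : invariant_sub B N).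
Hypotheses (bB : bop B) (MN : direct_sum M N).

Let sM := csub_subsp M.
Let sN := csub_subsp N.

Lemma direct0 x : csub_set M x -> csub_set N x -> x = 0.
Proof. by move=> Mx Nx; have : [set 0] x by rewrite -MN.2. Qed.

Lemma direct_full : addset (csub_set M) (csub_set N) = setT.
Proof. by apply/seteqP; split=> // x _; exact: MN.1. Qed.

(** Open mapping for the two inclusions bounds both projections, so an approximation of a sum
    approximates each component. *)
Lemma direct_closed (U V : set X) : closed U -> closed V ->
  U `<=` csub_set M -> V `<=` csub_set N -> closed (addset U V).
Proof.
move=> /closed_rnP cU /closed_rnP cV UM VN.
have [|C C0 hC] := open_mapping2 (bop_csub_val M) (bop_csub_val N).
  by move=> x; have [_ [_ [/csub_ex[u <-] /csub_ex[v <-] ->]]] := MN.1 x; exists u, v.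
have proj (a b : X) : csub_set M a -> csub_set N b -> rn a <= C * rn (a + b) /\ rn b <= C * rn (a + b).
  move=> Ma Nb; have [u [v [hu hv huv]]] := hC (a + b).
  have e : a - csub_val u = csub_val v - b.
    by apply/eqP; rewrite subr_eq addrAC [_ + csub_val u]addrC -huv addrK.
  have e0 : a - csub_val u = 0.
    apply: direct0; first by apply: (subspB sM) => //; exact: csub_valP.
    by rewrite e; apply: (subspB sN) => //; exact: csub_valP.
  have -> : a = csub_val u by apply/eqP; rewrite -subr_eq0 e0.
  have -> : b = csub_val v by apply/eqP; rewrite eq_sym -subr_eq0 -e e0.
  by rewrite -huv.
apply/closed_rnP => y hy; have [a [b [Ma Nb yab]]] := MN.1 y.
have apx e : 0 < e -> exists u v, [/\ U u, V v, rn (a - u) < e & rn (b - v) < e].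
  move=> e0; have [|_ [u [v [Uu Vv ->]]] h] := hy (e / C); first by rewrite divr_gt0.
  exists u, v; move: h; rewrite yab opprD addrACA ltr_pdivlMr // mulrC => h.
  have [h1 h2] := proj _ _ (subspB sM Ma (UM _ Uu)) (subspB sN Nb (VN _ Vv)).
  by split=> //; [exact: le_lt_trans h1 h|exact: le_lt_trans h2 h].
exists a, b; split=> //.
  by apply: cU => e /apx[u [v [Uu _ h _]]]; exists u.
by apply: cV => e /apx[u [v [_ Vv _ h]]]; exists v.
Qed.

Lemma direct_image (S : X -> X) (U V : set X) : bop S ->
  S @` addset U V = addset (S @` U) (S @` V).
Proof.
move=> bS; apply/seteqP; split=> x.
  move=> [_ [u [v [Uu Vv ->]]] <-]; exists (S u), (S v); rewrite (bopD bS).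
  by split.
by move=> [_ [_ [[u Uu <-] [v Vv <-] ->]]]; exists (u + v); [exists u, v|exact: (bopD bS)].
Qed.

Lemma direct_ker (U V : set X) : U `<=` csub_set M -> V `<=` csub_set N ->
  opker B `&` addset U V = addset (opker B `&` U) (opker B `&` V).
Proof.
move=> UM VN; apply/seteqP; split=> x.
  move=> [Bx [u [v [Uu Vv xuv]]]].
  have h : B u + B v = 0 by rewrite -(bopD bB) -xuv.
  have Bu0 : B u = 0.
    apply: direct0; first exact/BM/UM.
    rewrite (_ : B u = - B v); first by apply: (subspN sN); exact/BN/VN.
    by apply/eqP; rewrite -addr_eq0 h.
  by exists u, v; split=> //; split=> //; rewrite /opker /= -[RHS]h Bu0 add0r.
move=> [u [v [[Bu Uu] [Bv Vv] ->]]]; split; last by exists u, v.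
by rewrite /opker /= (bopD bB) Bu Bv addr0.
Qed.

Lemma addset00 : addset [set (0 : X)] [set 0] = [set 0].
Proof.
apply/seteqP; split=> x; first by move=> [_ [_ [-> -> ->]]]; rewrite /= addr0.
by move=> ->; exists 0, 0; rewrite addr0.
Qed.

Lemma direct_dims :
  dimq (opker B) [set 0%R] =
    (dimq (opker (restr BM)) [set 0%R] + dimq (opker (restr BN)) [set 0%R])%E /\
  dimq setT (range B) =
    (dimq setT (range (restr BM)) + dimq setT (range (restr BN)))%E.
Proof.
have sK := subsp_ker bB.
rewrite !dim_ker_restr // !codim_restr //; split.
  rewrite -[opker B in LHS]setIT -direct_full direct_ker // -[in LHS]addset00.
  apply: (dimq_direct sM sN direct0); try exact: subspI; try exact: subsp0.
  - by move=> x [].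
  - by move=> x [].
  - by move=> x ->; split; [exact: sK.1|exact: sM.1].
  - by move=> x ->; split; [exact: sK.1|exact: sN.1].
rewrite -direct_full direct_image //.
by apply: (dimq_direct sM sN direct0) => //; try exact: subsp_image; move=> _ [x ? <-];
  [exact: BM|exact: BN].
Qed.

(** The range of [iter p B] splits into its parts in [M] and [N]. On the [N]-part [B] is bijective;
    on the [M]-part nullity and deficiency have lost the same summand, which [dclass_sub] allows. *)
Lemma sum_classBR i p : Kato (restr BM) -> drazin (restr BN) p ->
  dclass i (dimq (opker (restr BM)) [set 0]) (dimq setT (range (restr BM))) ->
  classBR i B.
Proof.
move=> kS dA hc; have bS := bop_restr BM bB; have bA := bop_restr BN bB.
pose Mp := iter p B @` csub_set M; pose Np := iter p B @` csub_set N.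
have bp := bop_iter p bB.
have sMp : subsp Mp by exact: subsp_image.
have sNp : subsp Np by exact: subsp_image.
have itM n x : csub_set M x -> csub_set M (iter n B x) by move=> Mx; elim: n => //= n; exact: BM.
have itN n x : csub_set N x -> csub_set N (iter n B x) by move=> Nx; elim: n => //= n; exact: BN.
have MpM : Mp `<=` csub_set M by move=> _ [x Mx <-]; exact: itM.
have NpN : Np `<=` csub_set N by move=> _ [x Nx <-]; exact: itN.
have BMp : B @` Mp = @csub_val _ _ M @` range (iter p.+1 (restr BM)).
  by rewrite csub_val_image /Mp image_comp.
have BNp : B @` Np = Np.
  have E : Np = @csub_val _ _ N @` range (iter p (restr BN)) by rewrite csub_val_image.
  have dr := drazin_range dA; apply/seteqP; split=> x; rewrite E.
    move=> [_ [u Ru <-] <-]; exists (restr BN u) => //.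
    by rewrite -dr; exists u.
  by move=> [u]; rewrite -{1}dr => -[v Rv <-] <-; exists (csub_val v) => //; exists v.
have cMp : closed Mp.
  by rewrite /Mp -(csub_val_image BM p); exact/closed_csub_image/Kato_closed_iter.
have cBMp : closed (B @` Mp) by rewrite BMp; exact/closed_csub_image/Kato_closed_iter.
have cNp : closed Np.
  by rewrite /Np -(csub_val_image BN p); apply: closed_csub_image; exact: drazin_closed dA.
have sY := subsp_add sMp sNp.
pose Y := mkcsub sY (direct_closed cMp cNp MpM NpN).
have BMpMp : B @` Mp `<=` Mp.
  by move=> _ [_ [x Mx <-] <-]; exists (B x); [exact: BM|rewrite -iterSr].
have BY : B @` csub_set Y = addset (B @` Mp) Np.
  by rewrite /Y /= direct_image // BNp.
have iY : invariant_sub B Y.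
  move=> x Yx; have : (B @` csub_set Y) (B x) by exists x.
  by rewrite BY => -[u [v [/BMpMp ? ? ->]]]; exists u, v.
have bY := bop_restr iY bB.
exists p, Y, iY; split.
  by rewrite /Y /= -direct_image // direct_full.
apply/(classRP _ bY); split.
  rewrite (_ : range _ = @csub_val _ _ Y @^-1` (B @` csub_set Y)).
    apply: closed_csub_preimage; rewrite BY; apply: direct_closed => //.
    by move=> x /BMpMp/MpM.
  apply/seteqP; split=> u.
    by move=> [v _ <-]; exists (csub_val v) => //; exact: csub_valP.
  move=> [x /csub_ex[v <-] hv]; exists v => //; exact: csub_val_inj.
have [d d0 [h1 h2]] := iter_steps bS p; rewrite h1 h2 in hc.
have := dclass_sub d0 (dimq_ge0 _ _) (dimq_ge0 _ _) hc.
have sK := subsp_ker bB.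
rewrite dim_ker_restr // codim_restr //.
have -> : dimq (opker (restr BM) `&` range (iter p (restr BM))) [set 0] =
    dimq (opker B `&` csub_set Y) [set 0].
  rewrite dimq_csub ?image_set1; last 2 first.
  - by apply: subspI; [exact: subsp_ker|exact: subsp_range_iter].
  - exact: subsp0.
  congr dimq; apply/seteqP; split=> x.
    move=> [u [/(congr1 (@csub_val _ _ _)) /= Bu [v _ hv]] <-]; split=> //.
    exists (csub_val u), 0; rewrite addr0; split=> //; last exact: sNp.1.
    by exists (csub_val v); [exact: csub_valP|rewrite -val_iter_restr hv].
  move=> Bx; have : (opker B `&` addset Mp Np) x by [].
  rewrite direct_ker // => -[a' [b' [[Ba' Ma'] [Bb' Nb'] ->]]] {Bx}.
  have -> : b' = 0.
    move: Nb'; rewrite /Np -(csub_val_image BN p) => -[w Rw wb].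
    rewrite -wb (drazin_ker dA Rw) //; apply: csub_val_inj.
    by rewrite /= wb.
  rewrite addr0; move: Ma'; rewrite /Mp -(csub_val_image BM p) => -[w Rw wa].
  by exists w => //; split=> //; apply: csub_val_inj; rewrite /= wa.
have -> : dimq (range (iter p (restr BM))) (range (iter p.+1 (restr BM))) =
    dimq (csub_set Y) (B @` csub_set Y).
  rewrite dimq_csub; [|exact: subsp_range_iter|exact: subsp_range_iter].
  rewrite -BMp csub_val_image BY /Y /= -/Mp (dimq_direct sM sN direct0) //; last exact: subsp_image.
  by rewrite [X in (_ + X)%E]dimq_sub0 // adde0.
by [].
Qed.

End Decomposition.

Theorem corollary3p3 (R : realType) (X : completeNormedModType R[i])
    (infX : ldim [set: X] = +oo%E)
    (T : {linear X -> X}) (cT : continuous T)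
    (i : nat) (hi : (1 <= i <= 9)%N) :
  boundary (sigmaR i T) `&` limit_point (sigmaBR i T) `<=`
  boundary (sigma_gKM T).
Proof.
clear infX => l [[_ nint] lim].
have bT := continuous_bop cT.
have near (e : R) : 0 < e -> exists mu : R[i],
    [/\ mu != 0, rn mu < e, Kato (opshift T (l + mu)) & classR i (opshift T (l + mu))].
  (* Half of [e] is spent on a point in R_i, which may be [l] itself; the other half is kept for a
     further shift that makes the operator Kato. *)
  move=> e0; have [mu hmu cmu] : exists2 mu : R[i], rn mu < e / 2 & classR i (opshift T (l + mu)).
    apply: contrapT => no; apply: nint; apply/nbhs_CP; exists (e / 2); first lra.
    by move=> mu hmu; apply: contrapT => /contrapT c; apply: no; exists mu.
  have [d d0 hd] := classR_near (bop_opshift _ bT) cmu.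
  pose t := Num.min d (e / 2) / 2.
  have m0 : 0 < Num.min d (e / 2) by rewrite lt_min d0; lra.
  have md : Num.min d (e / 2) <= d by rewrite ge_min lexx.
  have me : Num.min d (e / 2) <= e / 2 by rewrite ge_min lexx orbT.
  have t0 : 0 < t by rewrite /t; lra.
  have good s : 0 < s -> s <= t -> mu + s%:C != 0 -> exists mu : R[i],
    [/\ mu != 0, rn mu < e, Kato (opshift T (l + mu)) & classR i (opshift T (l + mu))].
    move=> s0 st ne; have sC : s%:C != 0 :> R[i].
      by rewrite (inj_eq (@complexI _) s 0) gt_eqF.
    have rs : rn (s%:C : R[i]) = s by rewrite rn_real gtr0_norm.
    have [|] := hd _ sC; first by rewrite rs; rewrite /t in st; lra.
    rewrite opshiftD -addrA => k c; exists (mu + s%:C); split=> //.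
    by apply: le_lt_trans (rnD _ _) _; rewrite rs; rewrite /t in st; lra.
  (* The total shift must be non-zero; [mu + t] and [mu + t / 2] cannot both vanish. *)
  have [h|] := eqVneq (mu + t%:C) 0; last by apply: good.
  apply: (good (t / 2)); [lra|lra|].
  apply/eqP => h'; have : t%:C = (t / 2)%:C :> R[i] by apply: (addrI mu); rewrite h h'.
  by move=> /complexI ht; lra.
split; last first.
  move=> /nbhs_CP[e e0 hl]; have [mu [_ hmu kmu _]] := near e e0.
  by apply: (hl mu hmu); apply: kato_gKM => //; exact: bop_opshift.
(* For the closure it suffices that [l] itself belongs to the spectrum, so a decomposition at [l] is
   to be refuted. *)
apply: subset_closure => -[M [N [TM [TN [dMN kM mN]]]]].
have bT0 := bop_opshift l bT; set T0 := opshift T l in TM TN kM mN bT0.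
have [eps eps0 hk] := kato_dims (bop_restr TM bT0) kM.
have dr mu : mu != 0 -> exists p, drazin (opshift (restr TN) mu) p.
  move=> mu0; have [inv|/mN/(_ mu0)] := pselect (invertible_op (opshift (restr TN) mu)).
    by exists 0%N; exact: drazin_invertible.
  exact: drazin_pole (bop_restr TN bT0).
(* One shift in R_i inside the disc of [kato_dims] is enough: its dimensions are those of [T_M] plus
   a common summand from the [N]-part. *)
have hc : dclass i (dimq (opker (restr TM)) [set 0]) (dimq setT (range (restr TM))).
  have [mu [mu0 hmu _]] := near eps eps0; rewrite -opshiftD -/T0.
  have bS := bop_opshift mu bT0; move=> /(classRP _ bS)[_].
  have SM := invariant_opshift mu TM; have SN := invariant_opshift mu TN.
  have [-> ->] := direct_dims SM SN bS dMN.
  have [_ <- <-] := hk _ hmu; rewrite (restr_opshift TM SM).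
  have [p dp] := dr _ mu0; rewrite (restr_opshift TN SN) in dp.
  have [d d0 [-> ->]] := drazin_dims (bop_restr SN bS) dp.
  by rewrite ![(_ + d)%E]addeC; apply: (dclass_sub d0); exact: dimq_ge0.
(* An accumulation point supplies a point of the BR_i-spectrum in the disc other than [l], that is,
   a shift [m != 0], where the [N]-part has the Drazin property. *)
have [|y [yl]] := lim [set y | exists2 m : R[i], rn m < eps & y = l + m].
  by apply/nbhs_CP; exists eps => // m hm; exists m.
move=> nBR [m hm ym]; apply: nBR; rewrite ym -opshiftD -/T0.
have m0 : m != 0 by apply: contraNneq yl => h; rewrite ym h addr0.
have SM := invariant_opshift m TM; have SN := invariant_opshift m TN.
have [p dp] := dr _ m0; rewrite (restr_opshift TN SN) in dp.
have [kS hS1 hS2] := hk _ hm; rewrite (restr_opshift TM SM) in kS hS1 hS2.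
apply: (sum_classBR (bop_opshift m bT0) dMN kS dp).
by rewrite hS1 hS2.
Qed.
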